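(* Let $p$ be a prime and $G=\mathbb{Z}\times\mathbb{Z}_p=\langle z\rangle\times\langle a\rangle$. Let $\mathcal{S}$ be a Schur ring over $G$ such that $\mathbb{Z}^{(p)}=\langle z^p\rangle$ is an $\mathcal{S}$-subgroup. Suppose that $z\mathbb{Z}_p$ or $\{z,z^{-1}\}\mathbb{Z}_p=z\mathbb{Z}_p\cup z^{-1}\mathbb{Z}_p$ is the union of exactly two $\mathcal{S}$-classes. Then $\mathcal{S}$ is an automorphic Schur ring.
   Context: $F$ is a field of characteristic $0$; $\mathbb{Z}=\langle z\rangle$ infinite cyclic, $\mathbb{Z}_p=\langle a\rangle$ cyclic of order $p$, written multiplicatively. For finite $C\subseteq G$, $\overline{C}=\sum_{g\in C}g$ and $C^*=\{g^{-1}:g\in C\}$. A Schur ring over $G$ is a subspace $\mathcal{S}=\mathrm{Span}_F\{\overline{C}:C\in\mathcal{D}\}$ of $F[G]$, where $\mathcal{D}$ is a partition of $G$ into finite subsets with $\{1\}\in\mathcal{D}$, $C\in\mathcal{D}\Rightarrow C^*\in\mathcal{D}$, and each $\overline{C}\,\overline{D}$ a finite $F$-linear combination of the $\overline{E}$, $E\in\mathcal{D}$; members of $\mathcal{D}$ are $\mathcal{S}$-classes, an $\mathcal{S}$-subgroup is a subgroup that is a union of classes. $\mathcal{S}$ is automorphic if $\mathcal{S}=F[G]^{\mathcal{H}}$ (elements fixed by $\mathcal{H}$; classes the $\mathcal{H}$-orbits) for some finite $\mathcal{H}\le\operatorname{Aut}(G)$. *)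

(* Defs.v *)
From mathcomp Require Import all_boot all_order all_algebra.
Set Implicit Arguments. Unset Strict Implicit. Unset Printing Implicit Defensive.
Import Order.TTheory GRing.Theory Num.Theory.
Local Open Scope ring_scope.

(* The group G = Z x Z_p = <z> x <a>, encoded as pairs (m, k) standing for
   z^m a^k.  The group law (written multiplicatively in the paper) is
   componentwise addition. *)
Definition G (p : nat) := (int * 'Z_p)%type.

Definition gmul {p} (x y : G p) : G p := (x.1 + y.1, x.2 + y.2).
Definition ginv {p} (x : G p) : G p := (- x.1, - x.2).
Definition gone {p} : G p := (0, 0).

(* A partition D of G into finite subsets is given by a class map
   cl : G -> seq G, where cl x enumerates (without repetition) the class
   containing x. *)
Definition is_partition {p} (cl : G p -> seq (G p)) : Prop :=
  (forall x, uniq (cl x)) /\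
  (forall x, x \in cl x) /\
  (forall x y, y \in cl x -> cl y =i cl x).

(* Coefficient of g in  \bar{C} \bar{D}  where C = class of x, D = class of y:
   the number of pairs (c, d) in C x D with c d = g. *)
Definition prod_coef {p} (cl : G p -> seq (G p)) (x y g : G p) : nat :=
  (\sum_(c <- cl x) \sum_(d <- cl y) (gmul c d == g))%N.

(* Schur ring over G with coefficients in F (given by its partition):
   {1} is a class, C^* is a class for every class C, and each product
   \bar C \bar D is an F-linear combination of class sums, i.e. its
   F-coefficient function is constant on classes (it is finitely supported
   automatically since classes are finite). *)
Definition is_schur_ring (F : fieldType) {p} (cl : G p -> seq (G p)) : Prop :=
  is_partition cl /\
  cl gone =i [:: gone] /\
  (forall x, cl (ginv x) =i map ginv (cl x)) /\
  (forall x y g h, h \in cl g ->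
     ((prod_coef cl x y g)%:R : F) = (prod_coef cl x y h)%:R).

Definition union_of_classes {p} (cl : G p -> seq (G p)) (A : pred (G p)) : Prop :=
  forall x y, A x -> y \in cl x -> A y.

Definition union_of_two_classes {p} (cl : G p -> seq (G p)) (A : pred (G p)) : Prop :=
  exists x1 x2 : G p, x2 \notin cl x1 /\
    (forall y, A y <-> (y \in cl x1 \/ y \in cl x2)).

Definition Zp_sub (p : nat) : pred (G p) :=
  fun x => ((p%:Z %| x.1)%Z && (x.2 == 0)).

Definition zZp (p : nat) : pred (G p) := fun x => x.1 == 1.
Definition zzinvZp (p : nat) : pred (G p) := fun x => (x.1 == 1) || (x.1 == -1).

Definition is_aut {p} (f : G p -> G p) : Prop :=
  (forall x y, f (gmul x y) = gmul (f x) (f y)) /\ bijective f.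

Definition finite_aut_subgroup {p} (n : nat) (h : 'I_n -> G p -> G p) : Prop :=
  (forall i, is_aut (h i)) /\
  (exists i, h i =1 id) /\
  (forall i j, exists k, h k =1 h i \o h j) /\
  (forall i, exists j, h j \o h i =1 id).

(* S is automorphic: S = F[G]^H for some finite H <= Aut(G), i.e. the
   S-classes are exactly the H-orbits. *)
Definition automorphic {p} (cl : G p -> seq (G p)) : Prop :=
  exists (n : nat) (h : 'I_n -> G p -> G p),
    finite_aut_subgroup h /\
    (forall x y, y \in cl x <-> exists i, y = h i x).

Arguments Zp_sub p : clear implicits.
Arguments zZp p : clear implicits.
Arguments zzinvZp p : clear implicits.

(* Main.v *)
(* Write elements of G as z^m a^k, and specialise a to a primitive p-th root of
   unity zeta.  If U (one of z Z_p, {z, z^-1} Z_p) is the union of two classes C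
   and C', then, since the sum of U specialises to 0, every element of S
   supported on U specialises to a rational multiple of C.

   One-sided case, C = z A: since {z^p} is a class, C^(p+1) z^-p lies over U, so
   the character sum alpha of A satisfies alpha^(p+1) = r alpha.  A Galois
   argument shows that A with alpha^p rational is a point or the complement of
   a point, up to the trivial cases; thus some {z a^j} is a class, and
   translating by it carries the classes of z Z_p to every level.

   Two-sided case, C = z A + z^-1 A', with character sums alpha, alpha': if
   {z^p, z^-p} is a class, then projecting C^(p-1) (z^p + z^-p) and
   (C C)|_{Z_p} C to U gives alpha^(p-1) = r alpha', alpha'^(p-1) = r alpha and
   alpha alpha' rational.  Hence A and A' are again points up to complement, and
   {z a^j, z^-1 a^j'} is a class.  Multiplying by its powers maps all levels
   injectively to U, which bounds the number of classes of each level by 2.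
   If {z^p} is a class, then z Z_p is one as well, and Schur's theorem on
   multipliers (Frobenius modulo primes q <> p) determines all classes. *)
Require Import Defs.
From mathcomp Require Import all_boot all_order all_algebra.
From mathcomp Require Import all_field ring zify.
From mathcomp Require boolp.
Set Implicit Arguments. Unset Strict Implicit. Unset Printing Implicit Defensive.
Import Order.TTheory GRing.Theory Num.Theory.
Local Open Scope ring_scope.

(** * Character sums of subsets of Z_p *)

Section PrimeRoot.

Variables (p : nat) (z : algC).
Hypotheses (p_pr : prime p) (prim_z : p.-primitive_root z).

Let p_gt1 : (1 < p)%N := prime_gt1 p_pr.

Lemma Zp_lt (k : 'Z_p) : (k < p)%N.
Proof. by have := ltn_ord k; rewrite {2}(Zp_cast p_gt1). Qed.

Lemma expr_ZpD (k l : 'Z_p) : z ^+ (k + l)%R = z ^+ k * z ^+ l.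
Proof.
rewrite -exprD -[RHS](prim_expr_mod prim_z); congr (z ^+ _).
by rewrite /= {3}(Zp_cast p_gt1).
Qed.

Lemma expr_ZpM (k l : 'Z_p) : z ^+ (k * l)%R = (z ^+ k) ^+ l.
Proof.
rewrite -exprM -[RHS](prim_expr_mod prim_z); congr (z ^+ _).
by rewrite /= {3}(Zp_cast p_gt1).
Qed.

Lemma unitZp_neq0 (k : 'Z_p) : (k \is a GRing.unit) = (k != 0).
Proof.
rewrite -[k in LHS]natr_Zp unitZpE // prime_coprime //; case: (eqVneq k 0) => [->|k_neq0].
  by rewrite dvdn0.
by rewrite gtnNdvd ?Zp_lt // lt0n.
Qed.

Lemma sum_prim_root : \sum_(k : 'Z_p) z ^+ k = 0.
Proof.
have z_neq1 : z - 1 != 0.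
  rewrite subr_eq0; apply/eqP => z1; move: (prim_order_dvd prim_z 1).
  by rewrite z1 expr1n eqxx dvdn1 (gtn_eqF p_gt1).
apply: (mulfI z_neq1); rewrite mulr0.
have := subrX1 z p; rewrite (prim_expr_order prim_z) subrr => {2}->.
by congr (_ * _); rewrite -(big_mkord xpredT (fun k => z ^+ k)) (Zp_cast p_gt1) big_mkord.
Qed.

(** The minimal polynomial of [z] is the [p]-th cyclotomic polynomial, of size [p]. *)
Lemma root_size_lt (q : {poly rat}) :
  root (map_poly ratr q) z -> (size q < p)%N -> q = 0.
Proof.
have [r [Dr _] ->] := minCpolyP z; move=> r_dvd ltq; apply/eqP.
apply: contraTT ltq => q_neq0; rewrite -leqNgt.
suff <- : size r = p by exact: dvdp_leq.
rewrite -(size_map_poly (ratr : {rmorphism rat -> algC})) -Dr.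
rewrite (minCpoly_cyclotomic prim_z) size_cyclotomic totient_prime //.
by rewrite prednK // prime_gt0.
Qed.

(** Galois conjugation in polynomial form: [z ^+ m] is a root of the same cyclotomic polynomial,
    which divides every rational polynomial vanishing at [z]. *)
Lemma root_conj (q : {poly rat}) (m : nat) :
  coprime m p -> root (map_poly ratr q) z -> root (map_poly ratr q) (z ^+ m).
Proof.
move=> co_mp; have [r [Dr _] ->] := minCpolyP z; case/dvdpP => s ->.
rewrite rmorphM /= rootM -Dr (minCpoly_cyclotomic prim_z) root_cyclotomic //.
by rewrite prim_root_exp_coprime ?co_mp ?orbT // coprime_sym.
Qed.

Lemma lin_dep_const (f : 'Z_p -> int) :
  \sum_k (f k)%:~R * z ^+ k = 0 -> forall k, f k = f 0.
Proof.
(* Subtracting [c] times the sum of all powers kills the coefficient of degree p-1, so [q] is too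
   small to vanish at [z] without being 0. *)
move=> f0; pose c := f (inZp p.-1).
pose q : {poly rat} := \sum_(k : 'Z_p) (f k - c)%:~R *: 'X^k.
have coef_q (k : 'Z_p) : q`_k = (f k - c)%:~R.
  rewrite coef_sum (bigD1 k) //= coefZ coefXn eqxx mulr1 big1 ?addr0 // => i neq.
  by rewrite coefZ coefXn eq_sym (inj_eq val_inj) (negPf neq) mulr0.
suff q0 : q = 0.
  move=> k; have [] := (coef_q k, coef_q 0); rewrite q0 !coef0.
  by move=> /esym/eqP + /esym/eqP; rewrite !intr_eq0 !subr_eq0 => /eqP-> /eqP->.
apply: root_size_lt.
  rewrite /root /q rmorph_sum horner_sum /=; apply/eqP.
  transitivity (\sum_(k : 'Z_p) ((f k)%:~R * z ^+ k - c%:~R * z ^+ k)).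
    apply: eq_bigr => k _; rewrite map_polyZ map_polyXn hornerZ hornerXn /=.
    by rewrite ratr_int intrB mulrBl.
  by rewrite sumrB f0 -mulr_sumr sum_prim_root mulr0 subrr.
rewrite -(ltn_predK p_gt1) ltnS; apply/leq_sizeP => j lej.
case: (ltnP j p) => [ltj|gej].
  have jE : j = p.-1 by lia.
  have cE : (inZp p.-1 : 'Z_p) = p.-1 :> nat.
    by rewrite /= (Zp_cast p_gt1) modn_small //; lia.
  by rewrite jE -cE coef_q subrr.
rewrite coef_sum big1 // => i _; rewrite coefZ coefXn gtn_eqF ?mulr0 //.
exact: leq_trans (Zp_lt i) gej.
Qed.

(* Galois conjugation multiplies the character sum of [A] by a p-th root of
   unity, so every dilate of [A] is a translate of [A]; comparing the sums of
   the elements shows that all these dilations have the same center. *)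
Lemma rational_power_sum (A : {set 'Z_p}) (c : rat) :
  (\sum_(k in A) z ^+ k) ^+ p = ratr c ->
  exists j, forall k l, k != j -> l != j -> (k \in A) = (l \in A).
Proof.
set al := \sum_(k in A) _ => al_p.
have ind (B : {set 'Z_p}) : \sum_(k in B) z ^+ k = \sum_k (k \in B)%:Z%:~R * z ^+ k.
  by rewrite big_mkcond; apply: eq_bigr => k _; case: (k \in B); rewrite ?mul1r ?mul0r.
have [al0|al_neq0] := eqVneq al 0.
  exists 0 => k l _ _; have := al0; rewrite /al ind => /lin_dep_const H.
  by have := H k; have := H l => <-; do 2!case: (_ \in A).
have dil (u : 'Z_p) : u != 0 -> exists i, forall k, (k \in A) = (u * k + i \in A).
  move=> u_neq0.
  have cop : coprime u p.
    by rewrite coprime_sym -(unitZpE _ p_gt1) natr_Zp unitZp_neq0.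
  pose P : {poly rat} := \sum_(k in A) 'X^k.
  have evP (w : algC) : (map_poly ratr (P ^+ p - c%:P)).[w] = (\sum_(k in A) w ^+ k) ^+ p - ratr c.
    rewrite rmorphB rmorphXn /= map_polyC hornerD hornerN hornerC horner_exp.
    rewrite rmorph_sum horner_sum; congr (_ ^+ _ - _); apply: eq_bigr => k _.
    by rewrite /= map_polyXn hornerXn.
  have := @root_conj (P ^+ p - c%:P) u cop; rewrite /root !evP al_p subrr eqxx.
  move=> /(_ isT); set be := \sum_(k in A) _ => /eqP/subr0_eq be_p.
  have : (be / al) ^+ p = 1 by rewrite exprMn exprVn be_p -al_p divff // expf_neq0.
  case/(prim_rootP prim_z) => i0 /(canRL (divfK al_neq0)) beE.
  pose i : 'Z_p := inZp i0.
  have iE : z ^+ i = z ^+ i0.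
    by rewrite /= (Zp_cast p_gt1) (prim_expr_mod prim_z).
  exists (- i) => k; have uU : u \is a GRing.unit by rewrite unitZp_neq0.
  pose f (l : 'Z_p) : int := (u^-1 * l \in A)%:Z - (l - i \in A)%:Z.
  have fE : \sum_l (f l)%:~R * z ^+ l = 0.
    under eq_bigr do rewrite intrB mulrBl.
    rewrite sumrB; apply/eqP; rewrite subr_eq0; apply/eqP.
    transitivity be.
      rewrite /be (reindex_inj (mulrI uU)) [RHS]big_mkcond; apply: eq_bigr => l _ /=.
      rewrite mulrA mulVr // mul1r expr_ZpM.
      by case: (l \in A); rewrite ?mul1r ?mul0r.
    rewrite beE /al mulr_sumr [RHS](reindex_inj (addIr i)) big_mkcond; apply: eq_bigr => l _.
    rewrite addrK expr_ZpD iE mulrC.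
    by case: (l \in A); rewrite ?mul1r ?mul0r //= mulrC.
  have f_const := lin_dep_const fE.
  (* The constant value of [f] is 0 because both indicator functions have total [#|A|]. *)
  have f00 : f 0 = 0.
    have: \sum_l f l = 0.
      rewrite sumrB; apply/eqP; rewrite subr_eq0; apply/eqP.
      rewrite (reindex_inj (mulrI uU)) [RHS](reindex_inj (addIr i)).
      by apply: eq_bigr => l _ /=; rewrite mulrA mulVr // mul1r addrK.
    rewrite (eq_bigr _ (fun l _ => f_const l)) sumr_const card_ord => /eqP.
    by rewrite mulrn_eq0 /= => /eqP.
  have := f_const (u * k); rewrite f00 /f mulrA mulVr // mul1r => /eqP.
  by rewrite subr_eq0; do 2!case: (_ \in A).
have [A0 | /set0Pn[a0 a0A]] := eqVneq A set0.
  by exists 0 => k l _ _; rewrite A0 !inE.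
have [AT | ] := eqVneq A setT; first by exists 0 => k l _ _; rewrite AT !inE.
rewrite eqEsubset subsetT => /subsetPn[b0 _ b0A].
pose s : 'Z_p := #|A|%:R.
have sU : s \is a GRing.unit.
  rewrite unitZpE // prime_coprime // gtnNdvd //; first by apply/card_gt0P; exists a0.
  rewrite -[X in (_ < X)%N](Zp_cast p_gt1) -[X in (_ < X)%N]card_ord -cardsT.
  by apply: proper_card; apply/properP; split; [apply: subsetT | exists b0].
(* The common center can only be the barycenter of [A], defined since 0 < [#|A|] < p makes [s]
   invertible. *)
pose j := (\sum_(k in A) k) / s.
exists j.
have key (u k : 'Z_p) : u != 0 -> (k \in A) = (j + u * (k - j) \in A).
  move=> u_neq0; have [i Hi] := dil u u_neq0.
  have uU : u \is a GRing.unit by rewrite unitZp_neq0.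
  suff iE : i = j - u * j by rewrite Hi iE; congr (_ \in A); ring.
  apply: (mulrI sU).
  have -> : s * (j - u * j) = s * j - u * (s * j) by ring.
  rewrite [s * j]mulrC /j divrK //.
  apply/eqP; rewrite eq_sym subr_eq; apply/eqP.
  rewrite [in LHS](reindex_inj (addIr i)) (reindex_inj (mulrI uU)) /=.
  rewrite -(eq_bigl _ _ Hi) big_split /= sumr_const -mulr_sumr /s.
  by rewrite mulr_natl addrC.
move=> k l kj lj; rewrite (key ((l - j) / (k - j)) k).
  by rewrite divrK ?unitZp_neq0 ?subr_eq0 // addrC subrK.
rewrite -unitZp_neq0 unitrM unitrV !unitZp_neq0 !subr_eq0.
by rewrite kj lj.
Qed.

End PrimeRoot.

(** * Products in N[G] and class-invariant elements *)

(* A sequence over [V] stands for the element of N[V] whose coefficient at [g]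
   is the multiplicity of [g]; [conv] is then the product of N[V]. *)
Definition conv (V : zmodType) (s t : seq V) : seq V := [seq x + y | x <- s, y <- t].

Definition convn (V : zmodType) (s : seq V) (n : nat) : seq V := iter n (conv s) [:: 0].

Section Convolution.

Variable V : zmodType.
Implicit Types (s t : seq V) (g x y : V).

Lemma count_conv s t g :
  count_mem g (conv s t) = (\sum_(x <- s) count_mem (g - x)%R t)%N.
Proof.
elim: s => [|x s IHs]; first by rewrite big_nil.
rewrite big_cons [conv _ _]/= count_cat IHs count_map; congr addn.
by apply: eq_count => y; rewrite /= [RHS]eq_sym subr_eq [RHS]eq_sym addrC.
Qed.

Lemma convP s t g :
  reflect (exists x y, [/\ x \in s, y \in t & g = x + y]) (g \in conv s t).
Proof.
apply: (iffP allpairsP) => [[[x y] [/= ? ? ->]]|[x [y [? ? ->]]]]; first by exists x, y.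
by exists (x, y).
Qed.

Lemma count_map_opp s g : count_mem g [seq - x | x <- s] = count_mem (- g) s.
Proof. by rewrite count_map; apply: eq_count => x /=; rewrite eqr_oppLR. Qed.

End Convolution.

(** * Elements of a Schur ring with coefficients in N *)

Section SchurRing.

Variables (V : zmodType) (cl : V -> seq V).
Implicit Types (s t : seq V) (P : pred V) (g x y : V).

(** The field has disappeared: coefficients are compared in N, over any additive group. *)
Record schur_classes : Prop := SchurClasses {
  class_uniq : forall x, uniq (cl x);
  class_refl : forall x, x \in cl x;
  class_eq : forall x y, y \in cl x -> cl y =i cl x;
  class0 : cl 0 =i [:: 0];
  class_opp : forall x, cl (- x) =i [seq - y | y <- cl x];
  class_conv : forall x y g h, h \in cl g ->
    count_mem h (conv (cl x) (cl y)) = count_mem g (conv (cl x) (cl y)) }.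

Hypothesis S : schur_classes.

Definition invariant s := forall g h, h \in cl g -> count_mem h s = count_mem g s.

Definition closed P := forall x y, P x -> y \in cl x -> P y.

Lemma class_sym x y : (y \in cl x) = (x \in cl y).
Proof. by apply/idP/idP => h; rewrite (class_eq S h) (class_refl S). Qed.

Lemma closedE P x y : closed P -> y \in cl x -> P y = P x.
Proof.
move=> cP xy; apply/idP/idP => [Py|Px]; last exact: cP xy.
by apply: cP Py _; rewrite class_sym.
Qed.

Lemma closed_class x : closed (mem (cl x)).
Proof. by move=> y w /= yx wy; rewrite -(class_eq S yx). Qed.

Lemma closedD P Q : closed P -> closed Q -> closed [predD P & Q].
Proof.
move=> cP cQ x y /andP[Px Qx] xy.
by apply/andP; split; [rewrite /in_mem /= (closedE cQ xy) | apply: cP xy].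
Qed.

Lemma closed_ext P Q : P =1 Q -> closed P -> closed Q.
Proof. by move=> PQ cP x y; rewrite -!PQ; apply: cP. Qed.

Lemma closed_mem s : invariant s -> closed (mem s).
Proof.
move=> inv_s x y /= + xy; rewrite -!has_pred1 !has_count.
by rewrite (inv_s x y xy).
Qed.

(** This is the Schur-Wielandt principle. *)
Lemma closed_count s n : invariant s -> closed (fun x => count_mem x s == n).
Proof. by move=> inv_s x y /= + xy; rewrite (inv_s x y xy). Qed.

Lemma invariant_uniq s : uniq s -> closed (mem s) -> invariant s.
Proof. by move=> us cs g h gh; rewrite !count_uniq_mem //; congr nat_of_bool; apply: (closedE cs gh). Qed.

Lemma invariant_class x : invariant (cl x).
Proof. by apply: invariant_uniq; [apply: class_uniq | apply: closed_class]. Qed.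

Lemma invariant0 : invariant [:: 0].
Proof.
by apply: invariant_uniq => // x y; rewrite /= inE => /eqP->; rewrite (class0 S).
Qed.

Lemma invariant_perm s t : perm_eq s t -> invariant s -> invariant t.
Proof. by move=> /seq.permP st inv_s g h gh; rewrite -!st (inv_s g h gh). Qed.

Lemma invariant_cat s t : invariant s -> invariant t -> invariant (s ++ t).
Proof. by move=> is_ it_ g h gh; rewrite !count_cat (is_ g h) // (it_ g h). Qed.

Lemma invariant_filter P s : closed P -> invariant s -> invariant (filter P s).
Proof.
move=> cP inv_s g h gh; rewrite !count_filter.
have E x : count [predI pred1 x & P] s = (P x * count_mem x s)%N.
  case Px: (P x); rewrite ?mul1n ?mul0n.
    by apply: eq_count => y; rewrite /= /in_mem /=; case: eqP => // ->.
  by rewrite (@eq_count _ _ pred0) ?count_pred0 // => y; rewrite /= /in_mem /=; case: eqP => // ->.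
by rewrite !E (closedE cP gh) (inv_s g h).
Qed.

Lemma invariant_opp s : invariant s -> invariant [seq - x | x <- s].
Proof.
move=> inv_s g h gh; rewrite !count_map_opp; apply: inv_s.
by rewrite (class_opp S) map_f.
Qed.

(** The class of the first entry occurs in [s] as a whole; splitting it off leaves an invariant
    rest. The decomposition serves to extend [class_conv] bilinearly. *)
Lemma invariant_decomp s : invariant s -> exists r, perm_eq s (flatten (map cl r)).
Proof.
have [n] := ubnP (size s); elim: n s => // n IHn [|x s] lt_n inv_s.
  by exists [::].
have /count_subseqP[s1 /perm_to_subseq[t st] s1E] :
    forall y, (count_mem y (cl x) <= count_mem y (x :: s))%N.
  move=> y; have [xy|/count_memPn-> //] := boolP (y \in cl x).
  by rewrite count_uniq_mem ?(class_uniq S) // xy (inv_s x y xy) /= eqxx.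
have {}st : perm_eq (x :: s) (cl x ++ t).
  by apply: perm_trans st _; rewrite perm_cat2r perm_sym.
have inv_t : invariant t.
  move=> g h gh; move/seq.permP: st => st; apply/eqP.
  rewrite -(eqn_add2l (count_mem h (cl x))) {2}(invariant_class x gh).
  by rewrite -!count_cat -!st (inv_s g h).
have [|r tr] := IHn t _ inv_t.
  move: lt_n; rewrite (perm_size st) size_cat ltnS; apply: leq_trans.
  by rewrite -addn1 addnC leq_add2r lt0n size_eq0; case: (cl x) (class_refl S x).
by exists (x :: r); apply: perm_trans st _; rewrite /= perm_cat2l.
Qed.

Lemma count_conv_catr s t1 t2 g :
  count_mem g (conv s (t1 ++ t2)) = (count_mem g (conv s t1) + count_mem g (conv s t2))%N.
Proof. by rewrite !count_conv -big_split; apply: eq_bigr => x _; rewrite count_cat. Qed.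

Lemma invariant_conv s t : invariant s -> invariant t -> invariant (conv s t).
Proof.
move=> /invariant_decomp[r sr] /invariant_decomp[q tq].
apply: (@invariant_perm (conv (flatten (map cl r)) (flatten (map cl q)))).
  apply/allP => g _; rewrite /= !count_conv (perm_big _ sr); apply/eqP; apply: eq_bigr => x _.
  by rewrite (seq.permP tq).
elim: r {sr} => [|x r IHr] g h gh; first by rewrite !count_conv !big_nil.
rewrite /= !count_conv !big_cat -!count_conv /= (IHr _ _ gh); congr addn.
elim: q {tq IHr} => [|y q IHq] /=; first by rewrite !count_conv !big1.
by rewrite !count_conv_catr IHq (class_conv S _ _ gh).
Qed.

Lemma invariant_convn s n : invariant s -> invariant (convn s n).
Proof.
by move=> inv_s; elim: n => [|n IHn]; [apply: invariant0 | apply: invariant_conv].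
Qed.

End SchurRing.

(** * Automorphisms of Z x Z_p *)

Lemma prod_coefE p (cl : G p -> seq (G p)) x y g :
  prod_coef cl x y g = count_mem g (@conv (int * 'Z_p)%type (cl x) (cl y)).
Proof.
rewrite count_conv; apply: eq_bigr => c _.
rewrite -sum1_count [RHS]big_mkcond; apply: eq_bigr => d _ /=.
rewrite [d == _]eq_sym subr_eq eq_sym addrC /gmul.
by rewrite -[(_, _)]/((c : (int * 'Z_p)%type) + d); case: eqP.
Qed.

(** Characteristic 0 makes the map from N to [F] injective. *)
Lemma schur_ring_classes (F : fieldType) p (cl : G p -> seq (G p)) :
  [pchar F] =i pred0 -> is_schur_ring F cl -> @schur_classes (int * 'Z_p)%type cl.
Proof.
move=> /GRing.pcharf0P charF [[cu [cr ce]] [c0 [co cc]]]; split => // x y g h gh.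
have := cc x y g h gh; rewrite !prod_coefE.
move: (count_mem g _) (count_mem h _) => m n.
wlog le_mn : m n / (m <= n)%N.
  by move=> W; case: (leqP m n) => [|/ltnW] /W // E /esym/E.
move=> /eqP; rewrite eq_sym -subr_eq0 -natrB // charF subn_eq0 => le_nm.
by apply/eqP; rewrite eqn_leq le_nm.
Qed.

(* z |-> z^(+-1) a^i and a |-> a^u, for t = (sign, i, u). *)
Definition autG p (t : bool * 'Z_p * 'Z_p) (x : int * 'Z_p) : int * 'Z_p :=
  (if t.1.1 then - x.1 else x.1, x.1%:~R * t.1.2 + t.2 * x.2).

Section Automorphisms.

Variables (p : nat) (cl : int * 'Z_p -> seq (int * 'Z_p)).
Hypothesis S : schur_classes cl.

Let inv_param (t : bool * 'Z_p * 'Z_p) : bool * 'Z_p * 'Z_p :=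
  (t.1.1, - (if t.1.1 then - (t.2^-1 * t.1.2) else t.2^-1 * t.1.2), t.2^-1).

Let autK t : t.2 \is a GRing.unit -> cancel (autG t) (autG (inv_param t)).
Proof.
case: t => [[e i] u] /= uU [m k]; rewrite /autG /=; congr pair.
  by case: e; rewrite ?opprK.
by case: e; rewrite ?rmorphN /= mulrDr mulrA mulVr // mul1r; ring.
Qed.

Let autKV t : t.2 \is a GRing.unit -> cancel (autG (inv_param t)) (autG t).
Proof.
case: t => [[e i] u] /= uU [m k]; rewrite /autG /=; congr pair.
  by case: e; rewrite ?opprK.
have uE : u * u^-1 = 1 by rewrite mulrV.
transitivity (k * (u * u^-1) + m%:~R * i * (if e then (u * u^-1) - 1 else 1 - u * u^-1)).
  by case: e; rewrite ?rmorphN /=; ring.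
by rewrite uE; case: e; rewrite subrr; ring.
Qed.

(** The group consists of all class-preserving [autG t]. It is finite because the parameters form a
    finite type, so only transitivity on each class remains to be shown. *)
Lemma automorphic_aut :
  (forall x y, y \in cl x -> exists t : bool * 'Z_p * 'Z_p,
     [/\ t.2 \is a GRing.unit, y = autG t x & forall w, autG t w \in cl w]) ->
  @automorphic p cl.
Proof.
move=> H.
(* The condition ranges over an infinite group; [asbool] makes it boolean, so that the good
   parameters can be enumerated. *)
pose good (t : bool * 'Z_p * 'Z_p) :=
  (t.2 \is a GRing.unit) && boolp.asbool (forall w, autG t w \in cl w).
have goodP t : good t -> t.2 \is a GRing.unit /\ forall w, autG t w \in cl w.
  by case/andP => ? /boolp.asboolP.
have goodI t : t.2 \is a GRing.unit -> (forall w, autG t w \in cl w) -> good t.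
  by move=> ? ?; apply/andP; split=> //; apply/boolp.asboolP.
pose A := [pred t : bool * 'Z_p * 'Z_p | good t].
pose h (i : 'I_#|A|) := autG (enum_val i).
have hP i : (enum_val i).2 \is a GRing.unit /\ forall w, h i w \in cl w.
  by apply: goodP; apply: (enum_valP i).
have rankP t : good t -> exists i, h i = autG t.
  by move=> gt; exists (enum_rank_in (gt : t \in A) t); rewrite /h enum_rankK_in.
exists #|A|, h; split; [split; [|split; [|split]]|].
- move=> i; have [uU _] := hP i; split.
    move=> x y; rewrite /h; case: (enum_val i) => [[e a] u]; rewrite /autG /gmul /=.
    congr pair; first by case: e; rewrite ?opprD.
    by rewrite rmorphD /=; ring.
  by exists (autG (inv_param (enum_val i))); [apply: autK | apply: autKV].
- have id_aut w : autG (false, 0, 1) w = w.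
    by case: w => m k; rewrite /autG /= mulr0 add0r mul1r.
  have [|i hi] := rankP (false, 0, 1); last by exists i => w; rewrite hi id_aut.
  by apply: goodI => [|w]; rewrite ?unitr1 // id_aut (class_refl S).
- move=> i j; have [[iU iP] [jU jP]] := (hP i, hP j).
  pose t : bool * 'Z_p * 'Z_p := let ti := enum_val i in let tj := enum_val j in
    (ti.1.1 (+) tj.1.1,
     (if tj.1.1 then - ti.1.2 else ti.1.2) + ti.2 * tj.1.2, ti.2 * tj.2).
  have tE w : autG t w = h i (h j w).
    rewrite /h /t; case: (enum_val i) (enum_val j) => [[e a] u] [[e' a'] u'].
    case: w => m k; rewrite /autG /=; congr pair; first by case: e e' => [] []; rewrite ?opprK.
    by case: e'; rewrite /= ?rmorphN /=; ring.
  have [|k hk] := rankP t; last by exists k => w; rewrite hk tE.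
  apply: goodI => [|w]; first by rewrite /= unitrM iU.
  by rewrite tE -(class_eq S (jP w)).
- move=> i; have [iU iP] := hP i.
  have [|j hj] := rankP (inv_param (enum_val i)).
    apply: goodI => [|w]; first by rewrite /= unitrV.
    by rewrite (class_sym S) -[w in w \in _](autKV iU w); apply: iP.
  by exists j => w /=; rewrite hj /h autK.
move=> x y; split => [/H[t [tU -> tP]]|[i ->]]; last by have [_ ->] := hP i.
by have [|i <-] := rankP t; [apply: goodI | exists i].
Qed.

End Automorphisms.

(** * Specialisation at a root of unity *)

(* Here [z] is the root of unity to which a is specialised, not the generator of
   the infinite factor. *)
Definition char_sum p (z : algC) (n : int) (s : seq (int * 'Z_p)) : algC :=
  \sum_(x <- s | x.1 == n) z ^+ x.2.

Section CharacterSums.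

Variables (p : nat) (z : algC).
Hypotheses (p_pr : prime p) (prim_z : p.-primitive_root z).

Local Notation V := (int * 'Z_p)%type.
Local Notation ev := (@char_sum p z).
Implicit Types (s t : seq V) (x y : V) (n m : int) (k l j : 'Z_p).

Lemma char_sumE n s : ev n s = \sum_k (count_mem (n, k) s)%:R * z ^+ k.
Proof.
rewrite /char_sum; elim: s => [|[m l] s IHs].
  by rewrite big_nil big1 // => k _; rewrite mul0r.
rewrite big_cons IHs /=; under [RHS]eq_bigr do rewrite natrD mulrDl.
rewrite big_split /=.
have -> : \sum_k ((m, l) == (n, k))%:R * z ^+ k = if m == n then z ^+ l else 0.
  rewrite (bigD1 l) //= big1 ?addr0 => [|k neq]; rewrite xpair_eqE.
    by rewrite eqxx andbT; case: eqP; rewrite ?mul1r ?mul0r.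
  by rewrite [l == k]eq_sym (negPf neq) andbF mul0r.
by case: eqP; rewrite ?add0r.
Qed.

Lemma char_sum_mem n s : uniq s -> ev n s = \sum_(k | (n, k) \in s) z ^+ k.
Proof.
move=> us; rewrite char_sumE [RHS]big_mkcond; apply: eq_bigr => k _.
by rewrite count_uniq_mem //; case: (_ \in s); rewrite ?mul1r ?mul0r.
Qed.

Lemma char_sum_out n s : (forall x, x \in s -> x.1 != n) -> ev n s = 0.
Proof. by move=> H; rewrite /char_sum big1_seq // => x /andP[/eqP xn /H]; rewrite xn eqxx. Qed.

Lemma char_sum_filter (P : pred V) n s :
  (forall k, P (n, k)) -> ev n (filter P s) = ev n s.
Proof.
move=> H; rewrite /char_sum big_filter_cond; apply: eq_bigl => -[m k] /=.
by case: eqP => [->|]; rewrite ?H ?andbF.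
Qed.

Lemma char_sum_conv n s t :
  ev n (conv s t) = \sum_(x <- s) z ^+ x.2 * ev (n - x.1) t.
Proof.
elim: s => [|x s IHs]; first by rewrite /char_sum !big_nil.
rewrite big_cons -IHs /char_sum [conv _ _]/= big_cat /=; congr (_ + _).
rewrite big_map mulr_sumr; apply: eq_big => [y|y _]; last by rewrite expr_ZpD.
by rewrite /= [RHS]eq_sym subr_eq [RHS]eq_sym addrC.
Qed.

Lemma char_sum_conv_level m n s t :
  (forall x, x \in s -> x.1 = m) -> ev (m + n) (conv s t) = ev m s * ev n t.
Proof.
move=> sm; rewrite char_sum_conv /char_sum mulr_suml.
rewrite [RHS]big_seq_cond [LHS]big_seq; apply: eq_big => [x|x xs].
  by case: (boolP (x \in s)) => // /sm->; rewrite eqxx.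
by rewrite (sm _ xs) addrC addKr.
Qed.

(** Leading coefficients multiply: only extreme terms of both factors can reach level [e * d.+1].
    The sign [e] treats the highest and the lowest level alike. *)
Lemma char_sum_conv_sgn (e : int) (d : nat) s t : e * e = 1 ->
  (forall x, x \in s -> e * x.1 <= 1) ->
  (forall x, x \in t -> e * x.1 <= d) ->
  ev (e * d.+1%:Z) (conv s t) = ev e s * ev (e * d%:Z) t.
Proof.
move=> ee s1 td; rewrite char_sum_conv /char_sum mulr_suml [RHS]big_mkcond /=.
apply: eq_big_seq => x xs; case: eqP => [->|/eqP neq].
  by rewrite intS mulrDr mulr1 addrC addKr.
rewrite -/(char_sum _ _ _) char_sum_out ?mulr0 // => y /td yd; apply/eqP => E.
have := s1 x xs; rewrite le_eqVlt => /orP[/eqP xE|].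
  by case/eqP: neq; rewrite -[e]mulr1 -xE mulrA ee mul1r.
have -> : e * x.1 = d.+1%:Z - e * y.1.
  by rewrite E mulrBr mulrA ee mul1r subKr.
by move: yd; lia.
Qed.

Lemma char_sum_convn (e : int) s d : e * e = 1 ->
  (forall x, x \in s -> e * x.1 <= 1) ->
  ev (e * d%:Z) (convn s d) = ev e s ^+ d.
Proof.
move=> ee s1; have sd : forall d, forall x, x \in convn s d -> e * x.1 <= d%:Z.
  elim=> [|c IHc] x; first by rewrite inE => /eqP->; rewrite mulr0.
  case/convP => u [v [/s1 us /IHc vs ->]]; rewrite /= mulrDr intS.
  exact: lerD us vs.
elim: d => [|d IHd]; first by rewrite mulr0 /char_sum big_cons big_nil eqxx addr0.
by rewrite [convn _ _]/= char_sum_conv_sgn // ?IHd ?exprS //; apply: sd.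
Qed.

End CharacterSums.

(** * Sets made of two classes *)

Section TwoClasses.

Variables (p : nat) (z : algC).
Hypotheses (p_pr : prime p) (prim_z : p.-primitive_root z).

Local Notation V := (int * 'Z_p)%type.
Local Notation ev := (@char_sum p z).
Implicit Types (s t : seq V) (x y w : V) (n m : int) (k l j : 'Z_p).

Variable cl : V -> seq V.
Hypothesis S : schur_classes cl.

Variables (U : pred V) (x1 x2 : V).
Hypothesis x2_notin : x2 \notin cl x1.
Hypothesis U_classes : forall y, U y <-> (y \in cl x1 \/ y \in cl x2).

Lemma two_classes_disj y : y \in cl x1 -> y \in cl x2 -> False.
Proof.
move=> y1 y2; move/negP: x2_notin; apply.
by rewrite -(class_eq S y1) (class_eq S y2) (class_refl S).
Qed.

Lemma two_classes_closed : closed cl U.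
Proof.
move=> x y /U_classes[h|h] xy; apply/U_classes; [left | right];
by rewrite -(class_eq S h).
Qed.

Lemma two_classes_pigeonhole x y w :
  U x -> U y -> U w -> w \notin cl x -> w \notin cl y -> y \in cl x.
Proof.
have same c u v : u \in cl c -> v \in cl c -> u \in cl v.
  by move=> uc vc; rewrite (class_eq S vc).
move=> /U_classes[x_|x_] /U_classes[y_|y_] /U_classes[w_|w_] wx wy;
solve [exact: same y_ x_ | by move: wx; rewrite (same _ _ _ w_ x_)
  | by move: wy; rewrite (same _ _ _ w_ y_)].
Qed.

Lemma two_classes_second n k : (forall k, U (n, k)) ->
  ((n, k) \in cl x2) = ((n, k) \notin cl x1).
Proof.
move=> Un; apply/idP/idP => [k2|k1].
  by apply/negP => k1; apply: (two_classes_disj k1 k2).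
by case/U_classes: (Un k) => // k1'; rewrite k1' in k1.
Qed.

(* On the span of the two classes, modulo the sum of all of [U], everything is
   a rational multiple of the first class. *)
Lemma two_classes_line s :
  invariant cl s -> {subset s <= U} ->
  exists r : rat, forall n, (forall k, U (n, k)) -> ev n s = ratr r * ev n (cl x1).
Proof.
move=> inv_s sU; pose c1 := count_mem x1 s; pose c2 := count_mem x2 s.
exists (c1%:R - c2%:R) => n Un.
rewrite !char_sumE rmorphB /= !ratr_nat mulrBl.
(* The coefficient of [s] is [c2] everywhere plus [c1 - c2] on the first class; the constant part
   specialises to 0. *)
transitivity (\sum_k (c1%:R * ((count_mem (n, k) (cl x1))%:R * z ^+ k)
    - c2%:R * ((count_mem (n, k) (cl x1))%:R * z ^+ k) + c2%:R * z ^+ k)).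
  2: by rewrite big_split sumrB -!mulr_sumr /= (sum_prim_root p_pr prim_z) mulr0 addr0.
apply: eq_bigr => k _.
rewrite count_uniq_mem ?(class_uniq S) //.
case/U_classes: (Un k) => [k1|k2].
  by rewrite (inv_s _ _ k1) k1 mul1r subrK.
have:= two_classes_second k Un; rewrite k2 (inv_s _ _ k2) => /esym/negbTE->.
by rewrite mul0r !mulr0 subr0 add0r.
Qed.

Lemma class_char_sum0 n : ev n (cl x1) = 0 ->
  forall k l, ((n, k) \in cl x1) = ((n, l) \in cl x1).
Proof.
move=> e0 k l; pose f k : int := (count_mem (n, k) (cl x1))%:Z.
have /(lin_dep_const p_pr prim_z) H : \sum_k (f k)%:~R * z ^+ k = 0.
  by rewrite -[RHS]e0 char_sumE.
have := H l; rewrite -(H k) /f => -[]; rewrite !count_uniq_mem ?(class_uniq S) //.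
by do 2!case: (_ \in _).
Qed.

Lemma class_char_sum_rational n c : ev n (cl x1) ^+ p = ratr c ->
  exists j, forall k l, k != j -> l != j ->
    ((n, k) \in cl x1) = ((n, l) \in cl x1).
Proof.
rewrite char_sum_mem ?(class_uniq S) // => e.
have [|j H] := @rational_power_sum p z p_pr prim_z [set k | (n, k) \in cl x1] c.
  by rewrite -e; congr (_ ^+ _); apply: eq_bigl => k; rewrite inE.
by exists j => k l kj lj; have := H k l kj lj; rewrite !inE.
Qed.

End TwoClasses.

(** * Translation by singleton classes *)

Section Translation.

Variables (V : zmodType) (cl : V -> seq V).
Hypothesis S : schur_classes cl.

Lemma class_singleton t : invariant cl [:: t] -> cl t =i [:: t].
Proof.
move=> inv_t y; apply/idP/idP => [ty|]; last by rewrite inE => /eqP->; apply: class_refl S _.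
by apply: (closed_mem inv_t) ty; rewrite /= mem_head.
Qed.

Lemma singleton_opp t : invariant cl [:: t] -> invariant cl [:: - t].
Proof. exact: (@invariant_opp V cl S [:: t]). Qed.

Lemma singletonD t u : invariant cl [:: t] -> invariant cl [:: u] -> invariant cl [:: t + u].
Proof. exact: (@invariant_conv V cl S [:: t] [:: u]). Qed.

Lemma singletonMz t (n : int) : invariant cl [:: t] -> invariant cl [:: t *~ n].
Proof.
move=> inv_t; have H (d : nat) : invariant cl [:: t *+ d].
  by elim: d => [|d IHd]; [apply: invariant0 S | rewrite mulrS; apply: singletonD].
by case: n => n; [apply: H | rewrite NegzE mulrNz; apply/singleton_opp/H].
Qed.

(** Multiplying the class of [u + w] by the singleton class of [- u] gives an invariant element that
    contains [w], hence the whole class of [w]. *)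
Lemma class_shift t x y : invariant cl [:: t] -> (t + y \in cl (t + x)) = (y \in cl x).
Proof.
have aux u v w : invariant cl [:: u] -> v \in cl w -> u + v \in cl (u + w).
  move=> /singleton_opp inv_u vw.
  have /closed_mem/(_ w v) := invariant_conv S inv_u (@invariant_class V cl S (u + w)).
  case/(_ _ vw)/convP => [|_ [e [/[1!inE]/eqP-> ue ->]]]; last by rewrite addNKr.
  by apply/convP; exists (- u), (u + w); rewrite inE eqxx (class_refl S) addKr.
move=> inv_t; apply/idP/idP => [|/(aux t)]; last exact.
by move/(aux _ _ _ (singleton_opp inv_t)); rewrite !addKr.
Qed.

End Translation.

(** * The one-sided case *)

Definition level p (n : int) : seq (int * 'Z_p) := [seq (n, k) | k <- enum 'Z_p].

Section Levels.

Variable p : nat.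
Local Notation V := (int * 'Z_p)%type.
Variable cl : V -> seq V.
Hypothesis S : schur_classes cl.

Lemma mem_level n (x : V) : (x \in level p n) = (x.1 == n).
Proof.
apply/mapP/eqP => [[k _ ->] //|<-]; exists x.2; last by case: x.
exact: mem_enum.
Qed.

Lemma level_uniq n : uniq (level p n).
Proof. by rewrite map_inj_uniq ?enum_uniq // => k l [->]. Qed.

Lemma closed_level_invariant n :
  closed cl (fun x : V => x.1 == n) -> invariant cl (level p n).
Proof.
move=> c; apply: (invariant_uniq S) (level_uniq n) _.
by apply: closed_ext c => x; rewrite /= mem_level.
Qed.

Lemma closed_levelN n :
  closed cl (fun x : V => x.1 == n) -> closed cl (fun x : V => x.1 == - n).
Proof.
move/closed_level_invariant/(invariant_opp S)/closed_mem; apply: closed_ext.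
move=> x /=; apply/mapP/eqP => [[y]|xn].
  by rewrite mem_level => /eqP <- ->.
exists (- x); last by rewrite opprK.
by rewrite mem_level /= xn opprK.
Qed.

Lemma closed_levelD m n :
  closed cl (fun x : V => x.1 == m) -> closed cl (fun x : V => x.1 == n) ->
  closed cl (fun x : V => x.1 == m + n).
Proof.
move=> /closed_level_invariant im /closed_level_invariant i_n.
have := closed_mem (invariant_conv S im i_n); apply: closed_ext => x /=.
apply/convP/eqP => [[u [v []]]|xmn].
  by rewrite !mem_level => /eqP<- /eqP<- ->.
exists (m, x.2), (n, 0); rewrite !mem_level !eqxx; split=> //.
by rewrite [LHS]surjective_pairing xmn; congr pair; rewrite /= addr0.
Qed.

Lemma closed_levels : closed cl (fun x : V => x.1 == 1) ->
  forall n, closed cl (fun x : V => x.1 == n).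
Proof.
move=> c1; have c0 : closed cl (fun x : V => x.1 == 0).
  by rewrite -(subrr 1); apply: closed_levelD => //; apply: closed_levelN.
have H (d : nat) : closed cl (fun x : V => x.1 == d).
  by elim: d => // d IHd; rewrite intS; apply: closed_levelD.
by case=> d; [apply: H | rewrite NegzE; apply/closed_levelN/H].
Qed.

End Levels.

Section OneSided.

Variables (p : nat) (p_pr : prime p).
Local Notation V := (int * 'Z_p)%type.
Variable cl : V -> seq V.
Hypothesis S : schur_classes cl.
Hypothesis level_closed : forall n, closed cl (fun x : V => x.1 == n).
Hypothesis zp_closed : closed cl (@Zp_sub p).

(** Level [p] and <z^p> are unions of classes that meet in z^p alone. *)
Lemma level_singleton_p : invariant cl [:: (p%:Z, 0) : V].
Proof.
apply: (invariant_uniq S) => // x y; rewrite /= inE => /eqP-> xy.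
have /eqP y1 := level_closed (eqxx _) xy.
have /andP[_ /eqP y2] : Zp_sub p y.
  by apply: zp_closed xy; rewrite /Zp_sub /= dvdzz eqxx.
by rewrite inE [y]surjective_pairing y1 y2.
Qed.

Variables (x1 x2 : V).
Hypothesis x2_notin : x2 \notin cl x1.
Hypothesis U_classes : forall y : V, y.1 == 1 <-> (y \in cl x1 \/ y \in cl x2).

Lemma level1_singleton : exists j : 'Z_p, invariant cl [:: (1, j) : V].
Proof.
have [z prim_z] := C_prim_root_exists (prime_gt0 p_pr).
have U1 k : ((1, k) : V).1 == 1 by [].
have cl1 (y : V) : y \in cl x1 -> y.1 = 1 by move=> h; apply/eqP/U_classes; left.
pose s := conv [:: (- p%:Z, 0) : V] (convn (cl x1) p.+1).
have inv_s : invariant cl s.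
  apply: (invariant_conv S).
    have := singleton_opp S level_singleton_p; congr (invariant _ [:: _]).
    by congr pair; rewrite /= oppr0.
  by apply: invariant_convn => //; apply: invariant_class.
have convn1 d (y : V) : y \in convn (cl x1) d -> y.1 = d.
  elim: d y => [|d IHd] y; first by rewrite inE => /eqP->.
  by case/convP => u [v [/cl1 u1 /IHd v1 ->]]; rewrite /= u1 v1 intS.
have sU : {subset s <= (fun y : V => y.1 == 1)}.
  move=> y /convP[u [v [/[1!inE]/eqP-> /convn1 v1 ->]]].
  by rewrite unfold_in /= v1; lia.
have [r rE] := two_classes_line p_pr prim_z S x2_notin U_classes inv_s sU.
set a := char_sum z 1 (cl x1) in rE.
have sE : char_sum z 1 s = a ^+ p.+1.
  transitivity (char_sum z (- p%:Z + 1 * p.+1%:Z) s).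
    by congr (char_sum z _ s); lia.
  rewrite (char_sum_conv_level p_pr prim_z) => [|x /[1!inE] /eqP-> //].
  rewrite (char_sum_convn p_pr prim_z) ?mulr1 // => [|x /cl1-> //].
  by rewrite {1}/char_sum big_cons big_nil eqxx addr0 mul1r.
have := rE 1 U1; rewrite sE exprS mulrC.
move=> aE; have [c cE] : exists c : rat, a ^+ p = ratr c.
  have [->|a_neq0] := eqVneq a 0; last by exists r; apply: (mulIf a_neq0).
  by exists 0%:R; rewrite ratr_nat expr0n gtn_eqF ?prime_gt0.
have [j jE] := class_char_sum_rational p_pr prim_z S cE.
exists j; apply: (invariant_uniq S) => // x y; rewrite /= inE => /eqP-> jy.
have y1 : y.1 = 1 by apply/eqP; apply: level_closed jy => /=.
(* If the class of (1, j) had a second point [y], membership in [cl x1] would be constant on level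
   1, leaving no room for two classes. *)
apply: contraT => y_neq; have y2j : y.2 != j.
  by apply: contraNneq y_neq => <-; rewrite inE -y1 -surjective_pairing.
have {x}all_in (w : V) : w.1 = 1 -> (w \in cl x1) = (y \in cl x1).
  move=> w1E; rewrite [w]surjective_pairing w1E [y in RHS]surjective_pairing y1.
  have [->|w2j] := eqVneq w.2 j; last exact: jE.
  have -> : (1, y.2) = y by rewrite -y1 -surjective_pairing.
  exact/esym/(closedE S (@closed_class _ _ S x1) jy).
have x1U : x1.1 = 1 by apply/eqP/U_classes; left; apply: class_refl S _.
have x2U : x2.1 = 1 by apply/eqP/U_classes; right; apply: class_refl S _.
by move: x2_notin; rewrite (all_in x2) // -(all_in x1) // (class_refl S).
Qed.

(** The points (m, m j) are singleton classes, and translating by them makes every level a copy of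
    level 1: its base point, and one class of all other points. Automorphisms fixing the base points
    scale the distance to them by any unit. *)
Lemma automorphic_one_sided : @automorphic p cl.
Proof.
have [j inv_j] := level1_singleton.
have base (m : int) : invariant cl [:: (m, m%:~R * j) : V].
  have := singletonMz S m inv_j; congr (invariant _ [:: _]).
  by rewrite [LHS]surjective_pairing !raddfMz /= intz mulrzl.
have baseE (m : int) (y : V) : y \in cl (m, m%:~R * j) -> y = (m, m%:~R * j).
  by rewrite (class_singleton S (base m)) inE => /eqP.
have level_eq (x y : V) : y \in cl x -> y.1 = x.1.
  by move=> xy; apply/eqP; apply: level_closed xy => /=.
have char_cl (x y : V) : y.1 = x.1 -> x.2 != x.1%:~R * j -> y.2 != x.1%:~R * j -> y \in cl x.
  move=> yx x_nb y_nb; pose t : V := (1 - x.1, (1 - x.1)%:~R * j).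
  rewrite -(class_shift S _ _ (base (1 - x.1))) -/t.
  have nb (u : V) : u.1 = x.1 -> u.2 != x.1%:~R * j -> (1, j) \notin cl (t + u).
    move=> ux; apply: contra; rewrite (class_sym S) -[j in (1, j)]mul1r.
    move/(baseE 1) => /(congr1 snd) /=; rewrite mul1r rmorphB /= => E.
    by apply/eqP; rewrite -[LHS](addKr ((1 - x.1%:~R) * j)) E; ring.
  have tU (u : V) : u.1 = x.1 -> (t + u).1 == 1 by move=> ux; rewrite /= ux subrK.
  apply: (two_classes_pigeonhole S U_classes (tU _ erefl) (tU _ yx)) (nb _ _ _) (nb _ _ _) => //.
apply: automorphic_aut => // x y xy.
have yx := level_eq _ _ xy.
(* [A u] fixes z a^j and sends a to a^u. *)
pose A (u : 'Z_p) : bool * 'Z_p * 'Z_p := (false, (1 - u) * j, u).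
have AE u (w : V) : autG (A u) w = (w.1, w.1%:~R * j + u * (w.2 - w.1%:~R * j)).
  by rewrite /autG /=; congr pair; ring.
have A_cl u (w : V) : u \is a GRing.unit -> autG (A u) w \in cl w.
  move=> uU; rewrite AE; have [wb|wb] := eqVneq w.2 (w.1%:~R * j).
    by rewrite wb subrr mulr0 addr0 -[in X in X \in _]wb -surjective_pairing (class_refl S).
  apply: char_cl => //=; rewrite -subr_eq0 addrAC subrr add0r -(mulr0 u).
  by rewrite (inj_eq (mulrI uU)) subr_eq0.
have [xb|xb] := eqVneq x.2 (x.1%:~R * j).
  exists (A 1); rewrite unitr1; split=> // [|w]; last exact/A_cl/unitr1.
  move: xy; rewrite {1}[x]surjective_pairing xb => /baseE ->.
  by rewrite AE xb subrr mulr0 addr0.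
have yb : y.2 != x.1%:~R * j.
  apply: contra xb => /eqP yb; rewrite (class_sym S) in xy; move: xy.
  by rewrite [y]surjective_pairing yx yb => /baseE ->.
pose u := (y.2 - x.1%:~R * j) / (x.2 - x.1%:~R * j).
have uU : u \is a GRing.unit by rewrite unitrM unitrV !unitZp_neq0 // !subr_eq0 yb.
exists (A u); split=> // [|w]; last exact: A_cl.
rewrite AE divrK ?unitZp_neq0 ?subr_eq0 // addrC subrK -yx.
exact: surjective_pairing.
Qed.

End OneSided.

(** * The two-sided case *)

Definition abs_level p (n : nat) : pred (int * 'Z_p) := fun x => `|x.1|%N == n.

Section AbsLevels.

Variable p : nat.
Local Notation V := (int * 'Z_p)%type.
Variable cl : V -> seq V.
Hypothesis S : schur_classes cl.
Local Notation L := (@abs_level p).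

Let Ls n := undup (level p n%:Z ++ level p (- n%:Z)).

Let mem_Ls n x : (x \in Ls n) = L n x.
Proof. by rewrite mem_undup mem_cat !mem_level /abs_level; lia. Qed.

Lemma closed_abs_level_invariant n :
  closed cl (L n) -> exists2 s, invariant cl s & uniq s /\ forall x, (x \in s) = L n x.
Proof.
move=> cn; exists (Ls n); last by split; [apply: undup_uniq | apply: mem_Ls].
apply: (invariant_uniq S) (undup_uniq _) _.
by apply: closed_ext cn => x; rewrite /= mem_Ls.
Qed.

(* [g] is a torsion element iff all products [g * x^-1] with [|x.1| = 1]
   again lie in level 1, i.e. iff its coefficient in the square of level 1 is
   maximal. *)
Lemma closed_abs_level0 : closed cl (L 1) -> closed cl (L 0).
Proof.
move=> /closed_abs_level_invariant[s inv_s [us sE]].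
have := closed_count (n := size s) (invariant_conv S inv_s inv_s).
apply: closed_ext => g /=; rewrite count_conv.
have -> : (\sum_(x <- s) count_mem (g - x)%R s)%N = count (fun x => g - x \in s) s.
  by rewrite -sum1_count [RHS]big_mkcond; apply: eq_bigr => x _; rewrite count_uniq_mem //; case: (_ \in s).
rewrite -all_count.
apply/allP/idP => [H|g0 x]; last first.
  rewrite !sE /abs_level /= => x1; move: g0; rewrite /abs_level; lia.
(* The test point (1, 0) leaves levels 0 and 2 for [g]; (-1, 0) leaves levels 0 and -2. *)
have /H : (1, 0) \in s by rewrite sE.
have /H : (-1, 0) \in s by rewrite sE.
by rewrite !sE /abs_level /=; lia.
Qed.

(** The product of [L 1] and [L n.+1] has support [L n] together with [L n.+2]; removing the former
    is the induction step. *)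
Lemma closed_abs_levels : closed cl (L 1) -> forall n, closed cl (L n).
Proof.
move=> c1 n; suff [] : closed cl (L n) /\ closed cl (L n.+1) by [].
elim: n => [|n [IHn IHn1]]; first by split=> //; apply: closed_abs_level0.
split=> //; have [s1 inv1 [_ s1E]] := closed_abs_level_invariant c1.
have [s inv_s [_ sE]] := closed_abs_level_invariant IHn1.
have := closedD S (closed_mem (invariant_conv S inv1 inv_s)) IHn.
apply: closed_ext => x; rewrite /= [x \in L n]unfold_in.
apply/andP/idP => [[xn /convP[u [v []]]]|xn].
  rewrite s1E sE => u1 vn xE; move: xn u1 vn; rewrite xE /abs_level /=; lia.
split; first by move: xn; rewrite /abs_level; lia.
pose e : int := if 0 <= x.1 then 1 else -1.
have [e1 xe] : `|e|%N = 1 /\ `|x.1 - e|%N = n.+1.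
  move: xn; rewrite /abs_level /e; move: x.1 => m; case: (leP 0 m) => [m0|m0] mn; split=> //; move: m0 mn; clear; lia.
apply/convP; exists (e, 0), (x.1 - e, x.2); rewrite s1E sE /abs_level /= e1 xe; split=> //.
by rewrite [LHS]surjective_pairing; congr pair; rewrite /= ?add0r // addrC subrK.
Qed.

End AbsLevels.

Section TwoSided.

Variables (p : nat) (p_pr : prime p).
Local Notation V := (int * 'Z_p)%type.
Variable cl : V -> seq V.
Hypothesis S : schur_classes cl.
Hypothesis zp_closed : closed cl (@Zp_sub p).
Variables (x1 x2 : V).
Hypothesis x2_notin : x2 \notin cl x1.
Hypothesis U_classes : forall y : V, zzinvZp p y <-> (y \in cl x1 \/ y \in cl x2).

Lemma zzinvZpE : zzinvZp p =1 @abs_level p 1.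
Proof. by move=> x; rewrite /zzinvZp /abs_level; lia. Qed.

Lemma two_sided_abs_closed n : closed cl (@abs_level p n).
Proof.
apply: closed_abs_levels => //.
exact: closed_ext zzinvZpE (two_classes_closed S U_classes).
Qed.

Lemma two_sided_class_zp y : y \in cl (p%:Z, 0) -> y = (p%:Z, 0) \/ y = (- p%:Z, 0).
Proof.
move=> py; have yp : abs_level p y by apply: two_sided_abs_closed py; rewrite /abs_level /=.
have /andP[_ /eqP y2] : Zp_sub p y.
  by apply: zp_closed py; rewrite /Zp_sub /= dvdzz eqxx.
rewrite [y]surjective_pairing y2; move: yp; rewrite /abs_level.
case: y.1 => m; rewrite /= => /eqP mp; [left | right]; first by rewrite mp.
by rewrite NegzE mp.
Qed.

Hypothesis flip : (- p%:Z, 0) \in cl (p%:Z, 0).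

Let w : seq V := [:: (p%:Z, 0); (- p%:Z, 0)].

Let invariant_w : invariant cl w.
Proof.
have p0 := prime_gt0 p_pr.
apply: (invariant_uniq S) => [|x y].
  by rewrite /= andbT inE; apply/negP => /eqP[]; lia.
rewrite !inE => /orP[] /eqP->; rewrite ?(class_eq S flip) => /two_sided_class_zp[]->;
by rewrite eqxx ?orbT.
Qed.

Section Sums.

Variable z : algC.
Hypothesis prim_z : p.-primitive_root z.
Let a := char_sum z 1 (cl x1).
Let b := char_sum z (-1) (cl x1).

Let U1 k : zzinvZp p (1, k). Proof. by []. Qed.
Let U_1 k : zzinvZp p (-1, k). Proof. by []. Qed.

Let cl_sgn (e : int) : e = 1 \/ e = -1 -> forall x, x \in cl x1 -> e * x.1 <= 1.
Proof.
move=> e1 x x_; have : zzinvZp p x by apply/U_classes; left.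
by rewrite /zzinvZp => /orP[] /eqP->; case: e1 => ->.
Qed.

(** If both sums vanished, the class would contain all or nothing of each level, so the two classes
    would be levels 1 and -1. Then every level would be a union of classes, against [flip]. *)
Lemma two_sided_sums_neq0 : (a != 0) || (b != 0).
Proof.
apply/norP => -[/negbNE/eqP a0 /negbNE/eqP b0].
have a_const := class_char_sum0 p_pr prim_z S a0.
have b_const := class_char_sum0 p_pr prim_z S b0.
have c1 : closed cl (fun x : V => x.1 == 1).
  move=> x y /eqP x_1 xy; apply: contraT => y_n1.
  have y_1 : y.1 = -1.
    have : zzinvZp p y.
      by apply: (two_classes_closed S U_classes) xy; rewrite /zzinvZp x_1 eqxx.
    by rewrite /zzinvZp (negPf y_n1) => /eqP.
  have all_in (v : V) : zzinvZp p v -> (v \in cl x1) = (x \in cl x1).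
    have xyE := closedE S (@closed_class _ _ S x1) xy.
    rewrite /zzinvZp => /orP[/eqP v1|/eqP v1].
      by rewrite [v]surjective_pairing v1 [x]surjective_pairing x_1; apply: a_const.
    rewrite -[RHS]xyE [v]surjective_pairing v1 [y]surjective_pairing y_1.
    exact: b_const.
  have x1U : zzinvZp p x1 by apply/U_classes; left; apply: class_refl S _.
  have x2U : zzinvZp p x2 by apply/U_classes; right; apply: class_refl S _.
  by move: x2_notin; rewrite (all_in x2) // -(all_in x1) // (class_refl S).
have /eqP := @closed_levels p cl S c1 p%:Z (p%:Z, 0) _ (eqxx _) flip.
by have := prime_gt0 p_pr; rewrite /=; lia.
Qed.

(** Multiplying by [w] moves level -(p-1) to 1 and level p-1 to -1, which exchanges [a] and [b]; the
    factor [r] is common because both sums come from one element [s]. *)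
Lemma two_sided_sums_swap : exists r : rat, b ^+ p.-1 = ratr r * a /\ a ^+ p.-1 = ratr r * b.
Proof.
have p1 := prime_gt1 p_pr.
(* Only the extreme levels of the power are kept; their sums are a^(p-1) and b^(p-1). *)
pose s' := filter (@abs_level p p.-1) (convn (cl x1) p.-1).
pose s : seq V := filter (zzinvZp p : pred V) (conv w s').
have inv_s : invariant cl s.
  apply: invariant_filter => //; first exact: (two_classes_closed S U_classes).
  apply: invariant_conv => //; apply: invariant_filter => //.
    exact: two_sided_abs_closed.
  by apply: invariant_convn => //; apply: invariant_class.
have sU : {subset s <= zzinvZp p} by move=> y; rewrite mem_filter => /andP[].
have [r rE] := two_classes_line p_pr prim_z S x2_notin U_classes inv_s sU.
have s'E (e : int) : e = 1 \/ e = -1 -> char_sum z (e * p.-1%:Z) s' = char_sum z e (cl x1) ^+ p.-1.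
  move=> e1; rewrite char_sum_filter => [|k]; last by rewrite /abs_level /=; case: e1 => ->; lia.
  rewrite (char_sum_convn p_pr prim_z) //; last exact: cl_sgn.
  by case: e1 => ->.
have s'0 n : `|n|%N != p.-1 -> char_sum z n s' = 0.
  move=> n_neq; apply: char_sum_out => x; rewrite mem_filter => /andP[/eqP xE _].
  by apply: contraNneq n_neq => <-; rewrite xE.
have sE n : (forall k, zzinvZp p (n, k)) ->
    char_sum z n s = char_sum z (n - p%:Z) s' + char_sum z (n + p%:Z) s'.
  move=> Un; rewrite char_sum_filter // (char_sum_conv p_pr prim_z) !big_cons big_nil.
  by rewrite /= !expr0 !mul1r addr0 opprK.
exists r; split.
  rewrite -(rE 1 U1) sE // (s'0 (1 + p%:Z)); last by lia.
  rewrite addr0 -(s'E (-1)); last by right.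
  congr char_sum; lia.
rewrite -(rE (-1) U_1) sE // (s'0 (-1 - p%:Z)); last by lia.
rewrite add0r -(s'E 1); last by left.
congr char_sum; lia.
Qed.

(** The torsion part [s0] of C C has character sum 2ab, and multiplying C by it stays over levels 1
    and -1. Cancelling whichever of [a], [b] is nonzero gives 2ab = r. *)
Lemma two_sided_sums_prod : exists c : rat, a * b = ratr c.
Proof.
pose s0 := filter (@abs_level p 0) (conv (cl x1) (cl x1)).
pose s := conv s0 (cl x1).
have inv1 : invariant cl (cl x1) by apply: invariant_class.
have inv_s : invariant cl s.
  apply: invariant_conv => //; apply: invariant_filter => //.
    exact: two_sided_abs_closed.
  exact: invariant_conv.
have s00 x : x \in s0 -> x.1 = 0.
  by rewrite mem_filter => /andP[+ _]; rewrite /abs_level absz_eq0 => /eqP.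
have sU : {subset s <= zzinvZp p}.
  move=> y /convP[u [v [/s00 u0 v1 ->]]].
  have : zzinvZp p v by apply/U_classes; left.
  by rewrite unfold_in /zzinvZp /= u0 add0r.
have [r rE] := two_classes_line p_pr prim_z S x2_notin U_classes inv_s sU.
have sE n : char_sum z n s = char_sum z 0 s0 * char_sum z n (cl x1).
  by rewrite -[n in LHS]add0r (char_sum_conv_level p_pr prim_z).
have s0E : char_sum z 0 s0 = 2%:R * (a * b).
  rewrite char_sum_filter // (char_sum_conv p_pr prim_z).
  rewrite (bigID (fun x : V => x.1 == 1)) /=.
  rewrite (eq_bigr (fun x : V => z ^+ x.2 * b)) => [|x /eqP->]; last by rewrite sub0r.
  rewrite [X in _ + X]big_seq_cond [X in _ + X](eq_bigr (fun x : V => z ^+ x.2 * a)); last first.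
    move=> x /andP[x_ x_n1]; have : zzinvZp p x by apply/U_classes; left.
    by rewrite /zzinvZp (negPf x_n1) => /eqP->; rewrite sub0r opprK.
  rewrite -!mulr_suml -/(char_sum z 1 (cl x1)) -/a.
  have -> : \sum_(x <- cl x1 | (x \in cl x1) && (x.1 != 1)) z ^+ x.2 = b.
    rewrite /b /char_sum [RHS]big_seq_cond; apply: eq_bigl => x.
    case: (boolP (x \in cl x1)) => //= x_; have : zzinvZp p x by apply/U_classes; left.
    by rewrite /zzinvZp; lia.
  by rewrite [b * a]mulrC mulr_natl mulr2n.
have two_neq0 : 2%:R != 0 :> algC by rewrite pnatr_eq0.
exists (r / 2%:R); rewrite rmorphM fmorphV /= !ratr_nat.
apply: (mulfI two_neq0); rewrite [RHS]mulrCA divff // mulr1 -s0E.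
case/orP: two_sided_sums_neq0 => neq0; apply: (mulIf neq0).
  by rewrite /a -sE rE.
by rewrite /b -sE rE.
Qed.

(** The swap relations, multiplied by [b] and [a], make both p-th powers equal to r a b; they also
    show that [a] and [b] vanish together. *)
Lemma two_sided_sums_pow : [/\ a != 0, b != 0, a ^+ p = b ^+ p & exists c : rat, a ^+ p = ratr c].
Proof.
have [r [br ar]] := two_sided_sums_swap; have [c cE] := two_sided_sums_prod.
have p0 : (0 < p)%N := prime_gt0 p_pr; have p1 : (0 < p.-1)%N by have := prime_gt1 p_pr; lia.
have ab0 : (a == 0) = (b == 0).
  apply/eqP/eqP => h; [move/eqP: br | move/eqP: ar]; rewrite h mulr0 expf_eq0 p1 => /eqP -> //.
have := two_sided_sums_neq0; rewrite ab0 orbb => b0; rewrite b0.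
have apE : a ^+ p = ratr r * (a * b) by rewrite -(prednK p0) exprS ar mulrCA.
have bpE : b ^+ p = ratr r * (a * b) by rewrite -(prednK p0) exprS br mulrCA [b * a]mulrC.
by split=> //; rewrite ?apE ?bpE //; exists (r * c); rewrite cE rmorphM.
Qed.

(** Away from [j] the class contains all or nothing ([tau]), and [j] must be the exception or the
    sum would vanish. For p = 2 the complement of a point is a point, so [tau] can be normalised to
    false; p-th powers would not detect it there. *)
Lemma class_shape n : (char_sum z n (cl x1) != 0) ->
  (exists c : rat, char_sum z n (cl x1) ^+ p = ratr c) ->
  exists (j : 'Z_p) (tau : bool), [/\ p = 2 -> tau = false,
    forall k, ((n, k) \in cl x1) = tau (+) (k == j) &
    char_sum z n (cl x1) = (-1) ^+ tau * z ^+ j].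
Proof.
move=> e_neq0 [c cE].
have valE (j : 'Z_p) (tau : bool) : (forall k, ((n, k) \in cl x1) = tau (+) (k == j)) ->
    char_sum z n (cl x1) = (-1) ^+ tau * z ^+ j.
  move=> H; rewrite char_sumE.
  rewrite (eq_bigr (fun k : 'Z_p => tau%:R * z ^+ k + (if k == j then (-1) ^+ tau * z ^+ j else 0))).
    rewrite big_split -mulr_sumr /= (sum_prim_root p_pr prim_z) mulr0 add0r.
    by rewrite -big_mkcond big_pred1_eq.
  move=> k _; rewrite count_uniq_mem ?(class_uniq S) // H; case: eqP => [->|_].
    by case: tau {H}; rewrite /= ?expr1 ?expr0; ring.
  by rewrite addr0 addbF.
have [j jE] := class_char_sum_rational p_pr prim_z S cE.
pose tau := (n, j + 1) \in cl x1.
have j1 : j + 1 != j by rewrite -subr_eq0 addrAC subrr add0r oner_eq0.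
have off k : k != j -> ((n, k) \in cl x1) = tau by move=> kj; apply: jE.
have jj : ((n, j) \in cl x1) = ~~ tau.
  apply: contraNeq e_neq0 => h; have {}h : ((n, j) \in cl x1) = tau.
    by move: h; case: ((n, j) \in cl x1); case: (tau).
  rewrite char_sumE (eq_bigr (fun k : 'Z_p => tau%:R * z ^+ k)).
    by rewrite -mulr_sumr (sum_prim_root p_pr prim_z) mulr0.
  move=> k _; rewrite count_uniq_mem ?(class_uniq S) //.
  by have [->|/off->] := eqVneq k j; rewrite ?h.
have shape k : ((n, k) \in cl x1) = tau (+) (k == j).
  by have [->|/off->] := eqVneq k j; rewrite ?jj ?addbT ?addbF.
have [/andP[/eqP p2 tauT]|np2] := boolP ((p == 2%N) && tau).
  have shape' k : ((n, k) \in cl x1) = false (+) (k == j + 1).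
    rewrite shape tauT /=; case: (eqVneq k j) => [->|kj].
      by rewrite eq_sym (negPf j1).
    apply/esym/eqP; move: kj; clear -p2; move: k j; rewrite p2.
    by move=> [[|[|//]] ?] [[|[|//]] ?] // _; apply: val_inj.
  by exists (j + 1), false; split=> //; apply: valE.
by exists j, tau; split=> [p2||]; [move: np2; rewrite p2; case: (tau) | apply: shape | apply: valE].
Qed.

(** For odd p the p-th powers of the sums are their signs, so both levels have the same [tau], and
    the pair is the first class or its complement. The second clause amounts to j + j' = 0 for odd
    p; for p = 2 the only unit is 1. *)
Lemma two_sided_pair_sums : exists j j' : 'Z_p,
  closed cl (mem [:: (1, j) : V; (-1, j')]) /\
  (forall u : 'Z_p, u \is a GRing.unit -> u * (j + j') = j + j').
Proof.
have [a0 b0 abp [c cE]] := two_sided_sums_pow.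
have [j [tau [tau2 jE aE]]] := class_shape a0 (ex_intro _ c cE).
have [|j' [tau' [tau2' jE' bE]]] := class_shape b0; first by exists c; rewrite -/b -abp.
have zp k : (z ^+ k) ^+ p = 1 by rewrite exprAC (prim_expr_order prim_z) expr1n.
have one_neq : (1 == -1 :> algC) = false by rewrite -addr_eq0 -mulr2n pnatr_eq0.
have tauE : tau = tau'.
  have [p2|p_odd] := even_prime p_pr; first by rewrite tau2 // tau2'.
  move: abp; rewrite /a /b aE bE !exprMn !zp !mulr1 -!exprM ![(_ * p)%N]mulnC !exprM.
  rewrite -signr_odd p_odd expr1; case: (tau) (tau') => [] [] //= /eqP;
  by rewrite expr0 expr1 ?one_neq // eq_sym one_neq.
exists j, j'; split.
  have TE (v : V) : zzinvZp p v ->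
      (v \in [:: (1, j) : V; (-1, j')]) = tau (+) (v \in cl x1).
    case: v => m k; rewrite /zzinvZp !inE !xpair_eqE /= => /orP[] /eqP->.
      by rewrite jE addbA addbb addFb /= orbF.
    by rewrite jE' tauE addbA addbb addFb.
  have TU (v : V) : v \in [:: (1, j) : V; (-1, j')] -> zzinvZp p v.
    by rewrite !inE => /orP[] /eqP->.
  move=> x y /= xT xy; have xU := TU x xT.
  have yU := two_classes_closed S U_classes xU xy.
  rewrite TE //; rewrite TE // in xT.
  by have /= -> := closedE S (@closed_class _ _ S x1) xy.
move=> u uU; have [p2|p_odd] := even_prime p_pr.
  suff -> : u = 1 by rewrite mul1r.
  move: uU; rewrite unitZp_neq0 //; clear -p2; move: u; rewrite p2.
  by case=> [[|[|//]] ?] // _; apply: val_inj.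
suff -> : j + j' = 0 by rewrite mulr0.
have [q qE] := two_sided_sums_prod.
have zq : z ^+ (j + j')%R = ratr q.
  rewrite -qE /a /b aE bE tauE (expr_ZpD p_pr prim_z) mulrACA -expr2 sqrr_sign mul1r //.
(* A rational root of unity is real of modulus 1, so its square is 1. *)
have z1 : z ^+ ((j + j') + (j + j'))%R = 1.
  rewrite (expr_ZpD p_pr prim_z) -expr2 -real_normK; last by rewrite zq; apply/Creal_Crat/Crat_rat.
  suff /eqP-> : `|z ^+ (j + j')%R| == 1 by rewrite expr1n.
  by rewrite -(pexpr_eq1 (prime_gt0 p_pr)) // -normrX zp normr1.
have jj0 : (j + j') + (j + j') = 0.
  have : (p %| ((j + j') + (j + j'))%R)%N by rewrite (prim_order_dvd prim_z) z1.
  by apply: contraTeq => k_neq0; rewrite gtnNdvd ?Zp_lt // lt0n.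
apply/eqP; rewrite -(inj_eq (mulrI (_ : (2%:R : 'Z_p) \is a GRing.unit))).
  by rewrite mulr0 mulr_natl mulr2n jj0.
rewrite unitZpE ?prime_gt1 // prime_coprime //.
by apply: contraTN p_odd; rewrite dvdn_prime2 // => /eqP->.
Qed.

End Sums.
End TwoSided.

(** * All levels from a two-point union of classes *)

Section PairClass.

Variables (p : nat) (p_pr : prime p).
Local Notation V := (int * 'Z_p)%type.
Variable cl : V -> seq V.
Hypothesis S : schur_classes cl.
Variables (x1 x2 : V).
Hypothesis x2_notin : x2 \notin cl x1.
Hypothesis U_classes : forall y : V, zzinvZp p y <-> (y \in cl x1 \/ y \in cl x2).
Variables (j j' : 'Z_p).
Hypothesis pair_closed : closed cl (mem [:: (1, j) : V; (-1, j')]).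
Hypothesis unit_fix : forall u : 'Z_p, u \is a GRing.unit -> u * (j + j') = j + j'.

Local Notation L := (@abs_level p).

Let L_closed n : closed cl (L n).
Proof. exact: (two_sided_abs_closed p_pr S x2_notin U_classes). Qed.

(** The extreme levels of the [n]-th power of the pair; [T 0] lists the identity twice. *)
Let T (n : nat) : seq V := [:: (n%:Z, n%:R * j); (- n%:Z, n%:R * j')].

Let invariant_T n : invariant cl (T n).
Proof.
case: n => [|n].
  rewrite /T oppr0 !mul0r.
  exact: (invariant_cat (invariant0 S) (invariant0 S)).
elim: n => [|n IHn].
  rewrite /T !mul1r; apply: (invariant_uniq S) => //.
have inv1 : invariant cl (T 1).
  by rewrite /T !mul1r; apply: (invariant_uniq S).
have := invariant_filter S (@L_closed n.+2) (invariant_conv S inv1 IHn).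
rewrite [conv _ _]/= [filter _ _]/=.
have -> : L n.+2 ((1, 1%:R * j) + (n.+1%:Z, n.+1%:R * j)) by rewrite /abs_level /=; lia.
have -> : L n.+2 ((1, 1%:R * j) + (- n.+1%:Z, n.+1%:R * j')) = false by rewrite /abs_level /=; lia.
have -> : L n.+2 ((-1, 1%:R * j') + (n.+1%:Z, n.+1%:R * j)) = false by rewrite /abs_level /=; lia.
have -> : L n.+2 ((-1, 1%:R * j') + (- n.+1%:Z, n.+1%:R * j')) by rewrite /abs_level /=; lia.
congr (invariant _ [:: _; _]).
  by congr pair; rewrite /= -?mulrDl -?natrD //; lia.
by congr pair; rewrite /= -?mulrDl -?natrD //; lia.
Qed.

(* [off x] is the distance of [x] from the point of [T] lying in the same level. *)
Let base (m : int) : 'Z_p := m%:~R * j - (if m < 0 then m%:~R * (j + j') else 0).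
Let off (x : V) : 'Z_p := x.2 - base x.1.

Let T_off n x : (x \in T n) = L n x && (off x == 0).
Proof.
case: x => m k; rewrite /T /abs_level /off /base !inE !xpair_eqE subr_eq0 /=.
case: m => m; rewrite ?NegzE /=.
  rewrite subr0 -pmulrn; have -> : (Posz m == - n%:Z) = (m == 0)%N && (n == 0)%N by lia.
  rewrite eqz_nat; case: (eqVneq m n) => [->|] /=.
    by case: (eqVneq n 0%N) => [->|_]; rewrite /= ?orbF // !mul0r orbb.
  by case: (eqVneq m 0%N) => [->|]; rewrite //= eq_sym => /negbTE->.
rewrite eqr_opp eqz_nat /=; case: (eqVneq m.+1 n) => [<-|] //=.
by rewrite rmorphN /= mulrDr opprD addrA subrr add0r -mulNr opprK -pmulrn.
Qed.

(* Multiplying by the power of the opposite sign maps level +-(n+1) to level +-1. *)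
Let phi n (x : V) : V := if 0 <= x.1 then x + (- n%:Z, n%:R * j') else x + (n%:Z, n%:R * j).

Let phi_U n x : L n.+1 x -> zzinvZp p (phi n x).
Proof.
by case: x => m k; rewrite /phi /abs_level /zzinvZp /=; case: (leP 0 m) => /= m0; move: m0; lia.
Qed.

(** The product of the class of [x] with [T n] contains [phi n x], hence [phi n y]. Comparing
    levels, its factor from [T n] is the one used in [phi n y], so the other factor is [y]. *)
Let phi_class n x y : L n.+1 x -> L n.+1 y -> phi n y \in cl (phi n x) -> y \in cl x.
Proof.
move=> xL yL xy.
have c := closed_mem (invariant_conv S (@invariant_class _ _ S x) (invariant_T n)).
have /= /(c _ _) /(_ xy) /convP[e [v [ex vT E]]] : phi n x \in conv (cl x) (T n).
  apply/convP; rewrite /phi; case: ifP => _.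
    by exists x, (- n%:Z, n%:R * j'); rewrite !inE eqxx orbT (class_refl S).
  by exists x, (n%:Z, n%:R * j); rewrite !inE eqxx (class_refl S).
have eL := L_closed xL ex.
suff -> : y = e by [].
move: vT E yL eL; rewrite /phi !inE /abs_level; clear.
case: y e => [m k] [m' k'] /=.
case: (posnP n) => [->|n0] vT.
  have -> : v = 0 by case/orP: vT => /eqP->; rewrite mul0r ?oppr0.
  by rewrite oppr0 !mul0r !addr0 if_same => <-.
case/orP: vT => /eqP->; case: (leP 0 m) => m0 E mL m'L.
- by move: m0 (congr1 fst E) mL m'L n0; rewrite /=; clear; lia.
- exact: (addIr _ E).
- exact: (addIr _ E).
- by move: m0 (congr1 fst E) mL m'L n0; rewrite /=; clear; lia.
Qed.

(** By [phi_class] a positive level has at most two classes, so an element of the other type forces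
    [x] and [y] together. For [n = 0] multiplication by (1, j) replaces [phi], and the identity is
    the third element. *)
Let same_class n x y : L n x -> L n y -> (off x == 0) = (off y == 0) -> y \in cl x.
Proof.
case: n => [|n] xL yL xy.
  have [/eqP x_1 /eqP y_1] : x.1 == 0 /\ y.1 == 0.
    by move: xL yL; rewrite /abs_level !absz_eq0.
  have offE (v : V) : v.1 = 0 -> (off v == 0) = (v == 0).
    by case: v => m k /= ->; rewrite /off /base /= mul0r subr0 subr0 xpair_eqE eqxx.
  have [x0|x0] := eqVneq x 0.
    have /eqP-> : y == 0 by rewrite -offE // -xy offE // x0.
    by rewrite x0 (class_refl S).
  have y0 : y != 0 by rewrite -offE // -xy offE.
  have shift (u v : V) : u.1 = 0 -> v.1 = 0 -> v + (1, j) \in cl (u + (1, j)) -> v \in cl u.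
    move=> u1 v1 uv.
    have c := closed_mem (invariant_conv S (@invariant_class _ _ S u) (invariant_T 1)).
    have /= /(c _ _) /(_ uv) /convP[e [q [eu qT E]]] : u + (1, j) \in conv (cl u) (T 1).
      by apply/convP; exists u, (1, j); rewrite !inE mul1r eqxx (class_refl S).
    have : L 0 e by apply: L_closed eu; rewrite /abs_level u1.
    rewrite /abs_level absz_eq0 => /eqP e1.
    move: qT E; rewrite !inE !mul1r => /orP[] /eqP-> E; first by rewrite (addIr _ E).
    by have /= := congr1 fst E; rewrite v1 e1.
  have no0 (v : V) : v.1 = 0 -> v != 0 -> (0 + (1, j)) \notin cl (v + (1, j)).
    move=> v1 v0; apply: contra v0 => /shift -/(_ v1 erefl).
    by rewrite (class_sym S) (class0 S) inE.
  apply: shift => //.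
  apply: (two_classes_pigeonhole S U_classes _ _ _ (no0 _ x_1 x0) (no0 _ y_1 y0));
  by rewrite /zzinvZp /= ?x_1 ?y_1 ?add0r ?eqxx.
have pig w : L n.+1 w -> w \notin cl x -> w \notin cl y -> y \in cl x.
  move=> wL wx wy; apply: (phi_class xL yL).
  apply: (two_classes_pigeonhole S U_classes (phi_U xL) (phi_U yL) (phi_U wL)).
    by apply: contra wx; apply: phi_class.
  by apply: contra wy; apply: phi_class.
have off_class (u v : V) : L n.+1 u -> v \in cl u -> (off v == 0) = (off u == 0).
  move=> uL uv; have := closedE S (closed_mem (invariant_T n.+1)) uv.
  by rewrite /= !T_off uL (L_closed uL uv).
have sep (w v : V) : L n.+1 v -> (off w == 0) != (off v == 0) -> w \notin cl v.
  by move=> vL; apply: contraNN => vw; rewrite (off_class v).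
have offw k : off (n.+1%:Z, n.+1%:R * j + k) = k.
  by rewrite /off /base /= subr0 -pmulrn addrC addKr.
(* The third element has distance 1 if [x] lies on [T], and distance 0 otherwise. *)
have [x0|x0] := boolP (off x == 0).
  apply: (pig (n.+1%:Z, n.+1%:R * j + 1)); first by rewrite /abs_level /=.
    by apply: sep => //; rewrite offw x0 oner_eq0.
  by apply: sep => //; rewrite offw -xy x0 oner_eq0.
apply: (pig (n.+1%:Z, n.+1%:R * j + 0)); first by rewrite /abs_level /=.
  by apply: sep => //; rewrite offw eqxx (negPf x0).
by apply: sep => //; rewrite offw eqxx -xy (negPf x0).
Qed.

(** These send a to a^u, and z a^j to itself or, if [e], to z^-1 a^j'. *)
Let A (e : bool) (u : 'Z_p) : bool * 'Z_p * 'Z_p :=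
  (e, if e then j' - u * j else (1 - u) * j, u).

(** On negative levels the base points involve j + j', which [unit_fix] keeps unchanged under
    [u]. *)
Let off_A e u x : u \is a GRing.unit -> off (autG (A e u) x) = u * off x.
Proof.
move=> /unit_fix uJ; case: x => m k; rewrite /off /base /autG /=.
have H : u * (m%:~R * (j + j')) = m%:~R * (j + j') by rewrite mulrCA uJ.
have [m0|m0] := ltP m 0; case: e; rewrite ?rmorphN /=.
- have -> : (- m < 0) = false by lia.
  by rewrite !mulrBr H; ring.
- by rewrite m0 !mulrBr H; ring.
- have [mn|mn] := ltP (- m) 0; first by ring.
  have m_0 : m = 0 by lia.
  by rewrite m_0; ring.
by rewrite ltNge m0 /=; ring.
Qed.

Let A_class e u x : u \is a GRing.unit -> autG (A e u) x \in cl x.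
Proof.
move=> uU; apply: (@same_class `|x.1|%N); first by rewrite /abs_level.
  by rewrite /abs_level /=; case: (e); rewrite ?abszN.
by rewrite off_A // -{2}(mulr0 u) (inj_eq (mulrI uU)).
Qed.

(** Membership in [T] is constant on classes, so the distances of [x] and [y] vanish together and
    differ by a unit [u]; [e] records a change of sign of the level. *)
Lemma automorphic_two_sided : @automorphic p cl.
Proof.
apply: automorphic_aut => // x y xy.
have yL : L `|x.1|%N y by apply: L_closed xy; rewrite /abs_level.
have off0 : (off x == 0) = (off y == 0).
  have := closedE S (closed_mem (invariant_T `|x.1|%N)) xy.
  by rewrite /= !T_off yL /abs_level eqxx.
have [u uU yE] : exists2 u : 'Z_p, u \is a GRing.unit & off y = u * off x.
  have [x0|x0] := eqVneq (off x) 0.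
    by exists 1; rewrite ?unitr1 // x0 mulr0; apply/eqP; rewrite -off0 x0.
  exists (off y / off x); last by rewrite divrK // unitZp_neq0.
  by rewrite unitrM unitrV !unitZp_neq0 // x0 -off0 (negPf x0).
pose e := y.1 != x.1.
exists (A e u); split=> // [|w]; last exact: A_class.
have y1 : y.1 = (autG (A e u) x).1.
  by rewrite /= /e; case: eqP => //= yx; move: yL yx; rewrite /abs_level; lia.
have := off_A e x uU; rewrite -yE {1}/off -y1 => /addIr y2.
by rewrite [y]surjective_pairing y1 -y2 -surjective_pairing.
Qed.

End PairClass.

(** * Multipliers *)

Section Frobenius.

Variables (p q : nat) (q_pr : prime q).
Local Notation V := (int * 'Z_p)%type.
Local Notation M := 'M['F_q]_((Zp_trunc p).+2).

(* The regular representation of Z_p over F_q. *)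
Let reg (k : 'Z_p) : M := \matrix_(i, l) (l == i + k)%:R.

Let regD k l : reg (k + l) = reg k * reg l.
Proof.
apply/matrixP => i m; rewrite !mxE (bigD1 (i + k)) //= !mxE eqxx mul1r big1 => [|n neq].
  by rewrite addr0 addrA.
by rewrite !mxE (negPf neq) mul0r.
Qed.

Let reg0 : reg 0 = 1.
Proof. by apply/matrixP => i l; rewrite !mxE addr0 eq_sym. Qed.

Let regMn k n : reg (k *+ n) = reg k ^+ n.
Proof. by elim: n => [|n IHn]; rewrite ?reg0 // mulrS regD IHn exprS. Qed.

Let img (s : seq V) : M := \sum_(x <- s) reg x.2.

Let img_conv s t : img (conv s t) = img s * img t.
Proof.
elim: s => [|x s IHs]; first by rewrite /img !big_nil mul0r.
rewrite {1}/img [conv _ _]/= big_cat -/(conv s t) /= -/(img (conv s t)) IHs.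
rewrite /img big_cons mulrDl; congr (_ + _).
by rewrite big_map mulr_sumr; apply: eq_bigr => y _; rewrite -regD.
Qed.

Let img_convn s n : img (convn s n) = img s ^+ n.
Proof.
elim: n => [|n IHn]; first by rewrite /img /= big_cons big_nil reg0 addr0.
by rewrite [convn _ _]/= img_conv IHn exprS.
Qed.

(** The matrices [reg k] commute, so the q-th power is additive on their sums. *)
Let img_Frobenius s : img s ^+ q = img [seq x *+ q | x <- s].
Proof.
have charM : q \in [pchar M] by rewrite pchar_lalg pchar_Fp.
elim: s => [|x s IHs]; first by rewrite /img !big_nil expr0n gtn_eqF ?prime_gt0.
rewrite {1 2}/img /= !big_cons -/(img s) -/(img _).
rewrite -(pFrobenius_autE charM) pFrobenius_autD_comm.
  by rewrite !pFrobenius_autE IHs -regMn; congr (reg _ + _); rewrite raddfMn.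
by apply: commr_sum => y _; rewrite /GRing.comm -!regD addrC.
Qed.

(** Row 0 of the regular representation displays the coefficients modulo q; [img] forgets the level,
    harmless when there is only one. *)
Let img_count s n k : (forall x, x \in s -> x.1 = n) -> img s 0 k = (count_mem (n, k) s)%:R.
Proof.
move=> sn; rewrite /img summxE -sum1_count natr_sum [RHS]big_mkcond /=.
apply: eq_big_seq => -[m l] /sn /= ->; rewrite mxE add0r xpair_eqE eqxx /= eq_sym.
by case: (_ == _).
Qed.

Lemma count_convn_Frobenius (s : seq V) (n : int) (k : 'Z_p) :
  (forall x, x \in s -> x.1 = n) ->
  count_mem (n *+ q, k) (convn s q) =
    count_mem (n *+ q, k) [seq x *+ q | x <- s] %[mod q].
Proof.
move=> sn.
have fstMn (x : V) d : (x *+ d).1 = x.1 *+ d by rewrite raddfMn.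
have := congr1 (fun A : M => A 0 k) (img_Frobenius s); rewrite -img_convn.
rewrite !(@img_count _ (n *+ q)) => [E|x /mapP[y /sn yn ->]|x]; first 1 last.
- by rewrite fstMn yn.
- elim: (q) x => [|d IHd] x; first by rewrite inE => /eqP->.
  by case/convP => y [t [/sn y1 /IHd t1 ->]]; rewrite /= y1 t1 mulrS.
by have /(congr1 (@nat_of_ord _)) := E; rewrite !val_Fp_nat.
Qed.

End Frobenius.

Section Multipliers.

Variables (p : nat) (p_pr : prime p).
Local Notation V := (int * 'Z_p)%type.
Variable cl : V -> seq V.
Hypothesis S : schur_classes cl.
Hypothesis level_closed : forall n, closed cl (fun x : V => x.1 == n).

Let p_gt1 : (1 < p)%N := prime_gt1 p_pr.

Lemma pairMn (x : V) d : x *+ d = (x.1 *+ d, x.2 *+ d).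
Proof. by rewrite [LHS]surjective_pairing !raddfMn. Qed.

Lemma mulrn_coprime_inj d : (0 < d)%N -> coprime p d -> injective (fun x : V => x *+ d).
Proof.
move=> d0 co [m k] [n l]; rewrite /= !pairMn => E.
have /= E1 := congr1 fst E; have /= E2 := congr1 snd E; congr pair.
  by apply/eqP; rewrite -(eqr_pMn2r d0); apply/eqP.
apply: (mulrI (_ : (d%:R : 'Z_p) \is a GRing.unit)); first by rewrite unitZpE.
by rewrite !mulr_natl.
Qed.

Lemma class_level x y : y \in cl x -> y.1 = x.1.
Proof. by move=> xy; apply/eqP; apply: level_closed xy => /=. Qed.

(* Modulo q, the q-th power of a class sum is the sum of the q-th powers. *)
Lemma class_mulrn_prime q x y : prime q -> q != p ->
  y *+ q \in cl (x *+ q) -> y \in cl x.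
Proof.
move=> q_pr qp xy; have q0 := prime_gt0 q_pr.
have co : coprime p q by rewrite prime_coprime // dvdn_prime2 // eq_sym.
have inj := mulrn_coprime_inj q0 co.
(* Taking q-th powers is injective, so the coefficient of v^q in the sum of q-th powers is 1 or 0 as
   [v] is in the class or not. *)
have cnt v : v.1 = x.1 -> count_mem (v *+ q) (convn (cl x) q) = (v \in cl x) %[mod q].
  move=> vx; rewrite pairMn vx count_convn_Frobenius //; last by move=> u /class_level.
  by rewrite -vx -pairMn count_uniq_mem ?(mem_map inj) // map_inj_uniq // (class_uniq S).
have yx : y.1 = x.1.
  by have := class_level xy; rewrite !pairMn /= => /eqP; rewrite (eqr_pMn2r q0) => /eqP.
have := cnt y yx; rewrite (invariant_convn S q (@invariant_class _ _ S x) xy) cnt // (class_refl S).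
by case: (y \in cl x) => //; rewrite mod0n modn_small ?prime_gt1.
Qed.

Lemma class_mulrn d x y : (0 < d)%N -> coprime p d -> y *+ d \in cl (x *+ d) -> y \in cl x.
Proof.
have [n] := ubnP d; elim: n d x y => // n IHn d x y lt_n d0 co.
have [d1|d1] := leqP d 1; first by have -> : d = 1%N by lia.
have /dvdnP[e] := pdiv_dvd d; move: (pdiv d) (pdiv_prime d1) => q q_pr dE.
rewrite dE muln_gt0 coprimeMr in d0 co; rewrite dE !mulrnA => xy.
case/andP: d0 => e0 q0; case/andP: co => co_e co_q.
apply: (IHn e) => //.
  by apply: leq_trans (_ : d <= n)%N; rewrite // dE ltn_Pmulr ?prime_gt1.
apply: class_mulrn_prime xy => //.
by apply: contraTneq co_q => ->; rewrite prime_coprime // dvdnn.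
Qed.

Hypothesis inv_p : invariant cl [:: (p%:Z, 0) : V].
Hypothesis level1_class : forall x y : V, x.1 = 1 -> y.1 = 1 -> y \in cl x.

Let inv_pz (c : int) : invariant cl [:: (p%:Z * c, 0) : V].
Proof.
have := singletonMz S c inv_p; congr (invariant _ [:: _]).
by rewrite [LHS]surjective_pairing !raddfMz /= mul0rz -mulrzr intz.
Qed.

Let intZp_eq0 (n : int) : ((n%:~R : 'Z_p) == 0) = (p %| n)%Z.
Proof.
have natZp_eq0 (m : nat) : ((m%:R : 'Z_p) == 0) = (p %| m)%N.
  by rewrite -(inj_eq val_inj) /= val_Zp_nat.
by case: n => n; rewrite ?NegzE ?rmorphN /= ?oppr_eq0 -pmulrn natZp_eq0 ?dvdzN.
Qed.

(** With [d] inverse to [x.1] modulo p, the [d]-th powers lie in a level congruent to 1 modulo p, a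
    translate by a power of z^p of level 1, which is a single class. *)
Let class_prime_to_p x y : ~~ (p %| x.1)%Z -> y.1 = x.1 -> y \in cl x.
Proof.
rewrite -intZp_eq0 -unitZp_neq0 // => xU yx.
pose d : 'Z_p := (x.1%:~R)^-1.
have dU : d \is a GRing.unit by rewrite unitrV.
have co : coprime p d by rewrite -(unitZpE _ p_gt1) natr_Zp.
have d0 : (0 < d)%N by rewrite lt0n; move: dU; rewrite unitZp_neq0.
apply: (class_mulrn d0 co).
have : ((x.1 *+ d - 1)%:~R : 'Z_p) == 0.
  rewrite rmorphB rmorphMn /= -mulr_natl natr_Zp mulVr //.
  by rewrite subrr.
rewrite intZp_eq0 => /dvdzP[c cE].
have E (v : V) : v.1 = x.1 -> v *+ d = (p%:Z * c, 0) + (1, v.2 *+ d).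
  by move=> vx; rewrite pairMn vx; congr pair; rewrite /= ?add0r // mulrC -cE subrK.
by rewrite !E // class_shift //; apply: level1_class.
Qed.

Let class_p_multiple x k : (p %| x.1)%Z -> ((x.1, k) \in cl x) = ((0, k) \in cl (0, x.2)).
Proof.
case/dvdzP => c; rewrite mulrC => xE.
have E l : (x.1, l) = ((p%:Z * c, 0) : V) + (0, l) by congr pair; rewrite /= ?add0r ?addr0.
by rewrite {2}[x]surjective_pairing !E class_shift.
Qed.

(** Levels prime to p are single classes, on which the maps z -> z a^i are transitive while fixing
    the other levels pointwise. Those are translates of Z_p, whose classes are orbits of maps a ->
    a^u. *)
Lemma automorphic_full_level : @automorphic p cl.
Proof.
apply: automorphic_aut => // x y xy; have yx := class_level xy.
have yE : y = (x.1, y.2) by rewrite -yx -surjective_pairing.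
have [px|px] := boolP (p %| x.1)%Z; last first.
  have nU : (x.1%:~R : 'Z_p) \is a GRing.unit by rewrite unitZp_neq0 // intZp_eq0.
  exists (false, (y.2 - x.2) / x.1%:~R, 1); split=> [||w]; first exact: unitr1.
    by rewrite {1}yE /autG /= mulrC divrK // mul1r subrK.
  have [pw|pw] := boolP (p %| w.1)%Z; last exact: class_prime_to_p.
  move: pw; rewrite -intZp_eq0 => /eqP pw.
  by rewrite /autG /= pw mul0r add0r mul1r -surjective_pairing (class_refl S).
move: xy; rewrite yE class_p_multiple // => xy.
have [u uU uE] : exists2 u : 'Z_p, u \is a GRing.unit & y.2 = u * x.2 /\ 
    forall k, (0, u * k) \in cl (0, k).
  have [x0|x0] := eqVneq x.2 0.
    exists 1; rewrite ?unitr1 // mul1r; split=> [|k]; last by rewrite mul1r (class_refl S).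
    by move: xy; rewrite x0 (class0 S) inE => /eqP[].
  have y0 : y.2 != 0.
    by apply: contraNneq x0 => y0; move: xy; rewrite y0 (class_sym S) (class0 S) inE => /eqP[->].
  exists (y.2 / x.2); first by rewrite unitrM unitrV !unitZp_neq0 // y0.
  have xU : x.2 \is a GRing.unit by rewrite unitZp_neq0.
  rewrite divrK //; split=> // k.
  have [->|k0] := eqVneq k 0; first by rewrite mulr0 (class_refl S).
  have kU : k \is a GRing.unit by rewrite unitZp_neq0.
  (* The [d]-th power carries [k] to [x.2] and [u * k] to [y.2], so [class_mulrn] transfers the
     relation between [x] and [y] to every [k]. *)
  pose d : 'Z_p := x.2 / k.
  have dU : d \is a GRing.unit by rewrite unitrM unitrV xU.
  have co : coprime p d by rewrite -(unitZpE _ p_gt1) natr_Zp.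
  have d0 : (0 < d)%N by rewrite lt0n; move: dU; rewrite unitZp_neq0.
  have pairM (l : 'Z_p) : ((0, l) : V) *+ d = (0, d * l).
    by rewrite pairMn; congr pair; rewrite ?mul0rn // -mulr_natl natr_Zp.
  apply: (class_mulrn d0 co); rewrite !pairM.
  have -> : d * k = x.2 by rewrite divrK.
  by have -> : d * (y.2 / x.2 * k) = y.2 by rewrite mulrCA /d divrK // divrK.
exists (false, 0, u); split=> // [|w].
  by rewrite /autG /= mulr0 add0r; case: uE => <-.
rewrite /autG /= mulr0 add0r.
have [pw|pw] := boolP (p %| w.1)%Z; last exact: class_prime_to_p.
by rewrite class_p_multiple //; case: uE.
Qed.

End Multipliers.

(** * Conclusion *)

Section TwoSidedConclusion.

Variables (p : nat) (p_pr : prime p).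
Local Notation V := (int * 'Z_p)%type.
Variable cl : V -> seq V.
Hypothesis S : schur_classes cl.
Hypothesis zp_closed : closed cl (@Zp_sub p).
Variables (x1 x2 : V).
Hypothesis x2_notin : x2 \notin cl x1.
Hypothesis U_classes : forall y : V, zzinvZp p y <-> (y \in cl x1 \/ y \in cl x2).

Let L_closed n : closed cl (@abs_level p n).
Proof. exact: (two_sided_abs_closed p_pr S x2_notin U_classes). Qed.

(** Translation by z^p sends levels 1 and -1 to p+1 and p-1, which no class mixes. So level 1 is a
    union of classes, and a single one because level -1 takes the other. *)
Lemma automorphic_two_sided_no_flip :
  (- p%:Z, 0) \notin cl (p%:Z, 0) -> @automorphic p cl.
Proof.
move=> no_flip; have p_gt0 := prime_gt0 p_pr.
have inv_p : invariant cl [:: (p%:Z, 0) : V].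
  apply: (invariant_uniq S) => // x y; rewrite /= inE => /eqP-> py.
  have [->|yE] := two_sided_class_zp p_pr S zp_closed x2_notin U_classes py.
    by rewrite inE.
  by rewrite -yE py in no_flip.
have level1_closed : closed cl (fun x : V => x.1 == 1).
  have up x : x.1 == 1 -> abs_level p.+1 ((p%:Z, 0) + x : V).
    by rewrite /abs_level /= => /eqP->; lia.
  move=> x y x_1 xy.
  have yU : zzinvZp p y.
    by apply: (two_classes_closed S U_classes) xy; rewrite /zzinvZp x_1.
  have : abs_level p.+1 ((p%:Z, 0) + y : V).
    by apply: (L_closed (up x x_1)); rewrite class_shift.
  by case/orP: yU => // /eqP y1; rewrite /abs_level /= y1; lia.
have level_closed := closed_levels S level1_closed.
apply: (automorphic_full_level p_pr S level_closed inv_p) => x y x_1 y_1.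
have sep (v : V) : v.1 = 1 -> (-1, 0) \notin cl v.
  by move=> v1; apply/negP => /(class_level level_closed); rewrite v1.
by apply: (two_classes_pigeonhole S U_classes _ _ _ (sep _ x_1) (sep _ y_1));
  rewrite /zzinvZp ?x_1 ?y_1.
Qed.

Lemma automorphic_two_sided_classes : @automorphic p cl.
Proof.
have [flip|] := boolP ((- p%:Z, 0) \in cl (p%:Z, 0)); last exact: automorphic_two_sided_no_flip.
have [z prim_z] := C_prim_root_exists (prime_gt0 p_pr).
have [j [j' [T_closed fix_jj']]] :=
  two_sided_pair_sums p_pr S zp_closed x2_notin U_classes flip prim_z.
exact: (automorphic_two_sided p_pr S x2_notin U_classes T_closed fix_jj').
Qed.

End TwoSidedConclusion.

Theorem theorem3p10 (F : fieldType) (p : nat) (cl : G p -> seq (G p)) :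
  [pchar F] =i pred0 ->
  prime p ->
  is_schur_ring F cl ->
  union_of_classes cl (Zp_sub p) ->
  union_of_two_classes cl (zZp p) \/ union_of_two_classes cl (zzinvZp p) ->
  automorphic cl.
Proof.
move=> charF p_pr /(schur_ring_classes charF) S zp_closed.
case=> -[x1 [x2 [x2_notin U_classes]]].
  have level_closed := closed_levels S (two_classes_closed S U_classes).
  exact: (automorphic_one_sided p_pr S level_closed zp_closed x2_notin U_classes).
exact: (automorphic_two_sided_classes p_pr S zp_closed x2_notin U_classes).
Qed.
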